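(* Let $a \in C^{1}([0,\infty))$ satisfy $a(t)>0$ for all $t\ge 0$, $\sup\{a(t) : t\ge 0\}<+\infty$, $A_0:=\inf\{a(t): t\ge 0\}>0$, and $a'\in L^1(0,\infty)$. Let $u_0,u_1\in C_0^\infty(\mathbf{R})$, set $v_1(x):=\int_{-\infty}^{x}u_1(y)\,dy$, and assume $v_1\in L^2(\mathbf{R})$. Let $u$ be the solution of the Cauchy problem $$u_{tt}(t,x)-a(t)^2u_{xx}(t,x)=0,\quad (t,x)\in(0,\infty)\times\mathbf{R},\qquad u(0,x)=u_0(x),\quad u_t(0,x)=u_1(x),\quad x\in\mathbf{R}.$$ Then $$\|u(t,\cdot)\|^2\le \frac{1}{A_0^2}\,I_0^2\,e^{\frac{2}{A_0}\int_0^\infty |a'(s)|\,ds}\qquad\text{for all } t\ge 0,$$ where $I_0:=\left(\|v_1\|^2+a(0)^2\|u_0\|^2\right)^{1/2}$.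
   Context: $\|\cdot\|$ denotes the usual $L^2(\mathbf{R})$-norm, and $C_0^\infty(\mathbf{R})$ is the space of smooth compactly supported functions on $\mathbf{R}$. The solution $u$ is the unique strong solution in the class $C([0,\infty);H^2(\mathbf{R}))\cap C^1([0,\infty);H^1(\mathbf{R}))\cap C^2([0,\infty);L^2(\mathbf{R}))$; its existence, its uniqueness and its finite speed of propagation (with propagation speed $a_m:=\sup\{a(t):t\ge 0\}$) are known facts. *)

(* Defs.v *)
From HB Require Import structures.
From mathcomp Require Import all_boot all_order all_algebra.
From mathcomp Require Import all_classical all_reals all_analysis.
Set Implicit Arguments.
Unset Strict Implicit.
Unset Printing Implicit Defensive.
Import Order.TTheory GRing.Theory Num.Theory.
Import numFieldNormedType.Exports.
Local Open Scope classical_set_scope.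
Local Open Scope ring_scope.

(* Functions of x are represented by genuine functions R -> R and not by their
   a.e. classes: the predicates and norms below that involve L^2 or H^k do not
   depend on the representative. Functions of time are total on R, but only
   their values on [0, +oo[ matter. *)

Section Defs.
Context {R : realType}.
Local Notation mu := (@lebesgue_measure R).

Definition test_function (phi : R -> R) : Prop :=
  (forall n x, derivable (derive1n n phi) x 1) /\
  compact (closure [set x | phi x != 0]).

Definition L2 (f : R -> R) : Prop := f \in Lfun mu 2%:E.

(* As a real number; only meaningful on L2 (fine maps +oo to 0). *)
Definition L2norm (f : R -> R) : R := fine ('N[mu]_2%:E [EFin \o f])%E.

Definition is_weak_derivative (j : nat) (f g : R -> R) : Prop :=
  [/\ locally_integrable setT f,
      locally_integrable setT g &
      forall phi, test_function phi ->
        (\int[mu]_x (f x * derive1n j phi x))%R =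
        (-1) ^+ j * (\int[mu]_x (g x * phi x))%R].

Definition Hk (k : nat) : set (R -> R) :=
  [set f | L2 f /\
     forall j, (j <= k)%N -> exists g, L2 g /\ is_weak_derivative j f g].

(* A representative of the j-th weak derivative (unique a.e.) when f has one in
   L^2; the null function otherwise. *)
Definition weakD (j : nat) (f : R -> R) : R -> R :=
  xget (cst 0) [set g | L2 g /\ is_weak_derivative j f g].

Definition Hnorm (k : nat) (f : R -> R) : R :=
  Num.sqrt (\sum_(j < k.+1) L2norm (weakD j f) ^+ 2).

(* Limits s --> t, s >= 0, s != t, so that they are one-sided at t = 0. *)
Definition nbhs_half (t : R) : set_system R := within `[0, +oo[ t^'.

Definition is_derive_half (f df : R -> R) : Prop :=
  forall t, 0 <= t ->
    (f s - f t) / (s - t) @[s --> nbhs_half t] --> df t.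

Definition C1_half (f : R -> R) : Prop :=
  exists df, is_derive_half f df /\ {within `[0, +oo[, continuous df}.

Definition continuous_H (k : nat) (u : R -> R -> R) : Prop :=
  forall t, 0 <= t ->
    Hk k (u t) /\ Hnorm k (u s \- u t) @[s --> nbhs_half t] --> (0 : R).

Definition is_derive_H (k : nat) (u du : R -> R -> R) : Prop :=
  forall t, 0 <= t ->
    [/\ Hk k (u t), Hk k (du t) &
        Hnorm k (fun x => (u s x - u t x) / (s - t) - du t x)
          @[s --> nbhs_half t] --> (0 : R)].

(* u belongs to C^m([0, +oo[; H^k). *)
Fixpoint CmH (m k : nat) (u : R -> R -> R) : Prop :=
  if m is m'.+1 then exists du, is_derive_H k u du /\ CmH m' k du
  else continuous_H k u.

(* Time derivatives are those of L^2-valued functions (H^0 = L^2); u t stands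
   for u(t, .) and identities between elements of L^2 hold a.e. *)
Definition strong_solution (a u0 u1 : R -> R) (u : R -> R -> R) : Prop :=
  [/\ CmH 0 2 u, CmH 1 1 u, CmH 2 0 u &
      exists ut utt : R -> R -> R,
        [/\ is_derive_H 0 u ut, is_derive_H 0 ut utt,
            forall t, 0 < t ->
              {ae mu, forall x, utt t x - a t ^+ 2 * weakD 2 (u t) x = 0},
            {ae mu, forall x, u 0 x = u0 x} &
            {ae mu, forall x, ut 0 x = u1 x}]].

End Defs.

(* Main.v *)
Require Import Defs.
From HB Require Import structures.
From mathcomp Require Import all_boot all_order all_algebra.
From mathcomp Require Import all_classical all_reals all_analysis.
From mathcomp Require Import measurable_realfun.
From mathcomp Require Import ring lra.
Set Implicit Arguments.
Unset Strict Implicit.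
Unset Printing Implicit Defensive.
Import Order.TTheory GRing.Theory Num.Theory.
Import numFieldNormedType.Exports.
Local Open Scope classical_set_scope.
Local Open Scope ring_scope.

(** Formally, let w(t, x) be the integral of u_t(t, .) over ]-oo, x]. The wave
    equation becomes the first order system w_t = a^2 u_x, w_x = u_t, and for
    E(t) = ||w||^2 + a^2 ||u||^2 the cross terms 2 a^2 (<w, u_x> + <u, w_x>)
    cancel by integration by parts. What remains is
      E' = 2 a a' ||u||^2 <= (2 |a'| / A0) E,
    so Gronwall's inequality gives the bound, since E(0) = I0^2 and
    A0^2 ||u||^2 <= E.

    For a general solution w(t, .) is not obviously in L^2. Instead of deriving
    this from finite propagation speed, the primitive is regularized: for e > 0,
    w is replaced by K u_t, where K = (d/dx + e)^-1 is the convolution with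
    exp(- e x) on the positive half-line, a bounded operator on L^2. Two facts
    about K carry the proof.
    - K + K^* = 2 e K^* K (resolvent_adjoint). This is an identity between
      kernels, obtained by Fubini; it gives ||e K f|| <= ||f|| and
      ||f - e K f|| <= ||f||.
    - K f' = f - e K f when f' is the weak derivative of f
      (resolvent_weak_deriv).
    Together they yield <K u_xx, K u_t> = e^2 <K u, K u_t> - <u_t, u>
    (ip_resolvent_weak_deriv2), so that the cross terms cancel up to the error
    2 a^2 e^2 <K u, K u_t> <= e a E, and
      E' <= (2 |a'| / A0 + e sup a) E.
    Moreover K u_1 = v_1 - e K v_1, hence E(0) <= I0^2 for every e. Letting e
    tend to 0 in Gronwall's bound (energy_le) proves the theorem.

    Both K f' = f - e K f and the identification of the H^0 norm with the L^2
    norm rest on the du Bois-Reymond lemma (du_Bois_Reymond). *)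

(** * Inner product on square integrable functions *)

(** Sealed, so that ring and lra treat an inner product as an atom. *)
HB.lock Definition ip {R : realType} (f g : R -> R) : R :=
  \int[@lebesgue_measure R]_x (f x * g x).

Section InnerProduct.
Context {R : realType}.
Local Notation mu := (@lebesgue_measure R).
Implicit Types f g h : R -> R.

Lemma L2_measurable f : L2 f -> measurable_fun setT f.
Proof. by rewrite /L2 inE => /andP[+ _]; rewrite inE. Qed.

Lemma L2P f : L2 f <->
  measurable_fun setT f /\ mu.-integrable setT (EFin \o (fun x => f x ^+ 2)).
Proof.
split=> [Lf|[mf intf]].
  by split; [exact: L2_measurable|exact: Lfun2_integrable_sqr].
rewrite /L2 inE; apply/andP; split; first by rewrite inE.
rewrite inE/= /finite_norm unlock/= poweR_lty//.
move/integrableP : intf => [_]; apply: le_lt_trans.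
rewrite le_eqVlt; apply/orP; left; apply/eqP/eq_integral => x _ /=.
by rewrite powR_mulrn// normrX.
Qed.

Lemma L2D f g : L2 f -> L2 g -> L2 (fun x => f x + g x).
Proof. by move=> Lf Lg; have [_] := @Lfun_addr_closed _ _ _ mu 2%:E (lee1n 2); apply. Qed.

Lemma L2Z c f : L2 f -> L2 (fun x => c * f x).
Proof.
move=> /L2P[mf intf]; apply/L2P; split; first exact: measurable_funM.
have := integrableZl measurableT (c ^+ 2) intf.
by apply: eq_integrable => //= x _; rewrite exprMn EFinM.
Qed.

Lemma L2B f g : L2 f -> L2 g -> L2 (fun x => f x - g x).
Proof.
move=> Lf Lg; have /(L2D Lf) := L2Z (-1) Lg.
by congr L2; apply/funext => x; rewrite mulN1r.
Qed.

Lemma L2_le f g : L2 f -> measurable_fun setT g ->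
  (forall x, `|g x| <= `|f x|) -> L2 g.
Proof.
move=> /L2P[mf If] mg gf; apply/L2P; split => //.
apply: (@le_integrable _ _ _ mu setT _ _ (EFin \o (fun x => f x ^+ 2))) => //.
  by apply/measurable_EFinP; exact: measurable_funX.
move=> x _; rewrite /= lee_fin !normrX ler_pXn2r ?nnegrE//; exact: gf.
Qed.

(** Reduces linear statements to nonnegative functions, for which the iterated
    integrals below can be exchanged without integrability conditions. *)
Lemma L2_ind (P : (R -> R) -> Prop) :
  (forall f, L2 f -> (forall x, 0 <= f x) -> P f) ->
  (forall f g, L2 f -> L2 g -> P f -> P g -> P (fun x => f x - g x)) ->
  forall f, L2 f -> P f.
Proof.
move=> Pge0 PB f Lf.
have mf := L2_measurable Lf.
pose fp x := Num.max (f x) 0; pose fn x := Num.max (- f x) 0.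
have Lp : L2 fp.
  apply: (L2_le Lf); first exact: measurable_maxr.
  by move=> x; rewrite /fp; case: (leP (f x) 0) => f0; rewrite ?normr0.
have Ln : L2 fn.
  apply: (L2_le Lf); first by apply: measurable_maxr => //; exact: measurable_funN.
  by move=> x; rewrite /fn; case: (leP (- f x) 0) => f0; rewrite ?normr0// normrN.
have -> : f = (fun x => fp x - fn x).
  apply/funext => y; rewrite /fp /fn.
  by case: (leP (f y) 0) => f0; case: (leP (- f y) 0) => f1; lra.
by apply: PB => //; apply: Pge0 => // x; rewrite le_max lexx orbT.
Qed.

Lemma L2M_integrable f g : L2 f -> L2 g ->
  mu.-integrable setT (EFin \o (fun x => f x * g x)).
Proof. by move=> Lf Lg; apply/Lfun1_integrable; exact: Lfun2_mul_Lfun1. Qed.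

Lemma ipC f g : ip f g = ip g f.
Proof. by rewrite ip.unlock; apply: eq_Rintegral => x _; rewrite mulrC. Qed.

Lemma ipDl f g h : L2 f -> L2 g -> L2 h ->
  ip (fun x => f x + g x) h = ip f h + ip g h.
Proof.
move=> Lf Lg Lh; rewrite ip.unlock -RintegralD//; [|exact: L2M_integrable..].
by apply: eq_Rintegral => x _; rewrite mulrDl.
Qed.

Lemma ipZl c f h : L2 f -> L2 h -> ip (fun x => c * f x) h = c * ip f h.
Proof.
move=> Lf Lh; rewrite ip.unlock -RintegralZl//; last exact: L2M_integrable.
by apply: eq_Rintegral => x _; rewrite mulrA.
Qed.

Lemma ipBl f g h : L2 f -> L2 g -> L2 h ->
  ip (fun x => f x - g x) h = ip f h - ip g h.
Proof.
move=> Lf Lg Lh; rewrite ip.unlock -RintegralB//; [|exact: L2M_integrable..].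
by apply: eq_Rintegral => x _; rewrite mulrBl.
Qed.

Lemma ipDr f g h : L2 f -> L2 g -> L2 h ->
  ip h (fun x => f x + g x) = ip h f + ip h g.
Proof. by move=> *; rewrite ipC ipDl// !(ipC h). Qed.

Lemma ipZr c f h : L2 f -> L2 h -> ip h (fun x => c * f x) = c * ip h f.
Proof. by move=> *; rewrite ipC ipZl// !(ipC h). Qed.

Lemma ipBr f g h : L2 f -> L2 g -> L2 h ->
  ip h (fun x => f x - g x) = ip h f - ip h g.
Proof. by move=> *; rewrite ipC ipBl// !(ipC h). Qed.

Lemma ip_ge0 f : 0 <= ip f f.
Proof. by rewrite ip.unlock; apply: Rintegral_ge0 => x _; rewrite -expr2 sqr_ge0. Qed.

Lemma L2norm_ge0 f : 0 <= L2norm f.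
Proof. by rewrite /L2norm fine_ge0// Lnorm_ge0. Qed.

Lemma sqr_L2norm f : L2norm f ^+ 2 = ip f f.
Proof.
have := @poweR_Lnorm _ _ _ mu (EFin \o f) 2 _; rewrite pnatr_eq0 => /(_ isT) h.
rewrite /L2norm -powR_mulrn ?fine_ge0 ?Lnorm_ge0// -fine_poweR h ip.unlock /Rintegral.
by congr fine; apply: eq_integral => x _ /=; rewrite powR_mulrn// real_normK ?num_real.
Qed.

Lemma L2_CauchySchwarz f g : L2 f -> L2 g -> `|ip f g| <= L2norm f * L2norm g.
Proof.
move=> Lf Lg; have fg := L2M_integrable Lf Lg.
rewrite ip.unlock; apply: le_trans (le_normr_Rintegral measurableT fg) _.
have finN h : L2 h -> ('N[mu]_2%:E[EFin \o h])%E \is a fin_num.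
  by rewrite /L2 inE => /andP[_]; rewrite inE/= ge0_fin_numE ?Lnorm_ge0.
rewrite /L2norm -fineM ?finN// fine_le ?fin_numM ?finN//.
  by apply/integrable_fin_num => //; exact: (integrable_norm fg).
have h := @hoelder _ _ _ mu f g 2 2 (L2_measurable Lf) (L2_measurable Lg) _ _ _.
rewrite -[leLHS]/(\int[mu]_x `|(EFin \o (f \* g)%R) x|)%E -Lnorm1.
by apply: h => //; rewrite -div1r [RHS]splitr.
Qed.

Lemma ae_imply2 (P Q S : R -> Prop) : (forall x, P x -> Q x -> S x) ->
  {ae mu, forall x, P x} -> {ae mu, forall x, Q x} -> {ae mu, forall x, S x}.
Proof. by move=> PQS; apply: filterS2; first exact: (ae_filter_ringOfSetsType mu). Qed.

Lemma eq_ip f f' g g' : L2 f -> L2 f' -> L2 g -> L2 g' ->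
  {ae mu, forall x, f x = f' x} -> {ae mu, forall x, g x = g' x} ->
  ip f g = ip f' g'.
Proof.
move=> Lf Lf' Lg Lg' ff' gg'; rewrite ip.unlock /Rintegral; congr fine.
apply: ae_eq_integral => //.
- by have /integrableP[] := L2M_integrable Lf Lg.
- by have /integrableP[] := L2M_integrable Lf' Lg'.
- by move: ff' gg'; apply: ae_imply2 => x /= -> ->.
Qed.

Lemma EFin_ip f g : L2 f -> L2 g ->
  ((ip f g)%:E = \int[mu]_x (f x * g x)%:E)%E.
Proof.
move=> Lf Lg; rewrite ip.unlock fineK//.
by apply: integrable_fin_num => //; exact: (L2M_integrable Lf Lg).
Qed.

End InnerProduct.

(** * Smooth functions and a flat function *)

Section Smooth.
Context {R : realType}.
Implicit Types f g : R -> R.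

(** Recursion on the derivative instead of iterated derivatives: the closure
    properties below then follow from the rules for is_derive, the derivative
    at each stage being given by an explicit formula. *)
Fixpoint diff_order (n : nat) f : Prop :=
  if n is n'.+1 then
    exists df : R -> R, (forall x : R, is_derive x 1 f (df x)) /\ diff_order n' df
  else forall x : R, derivable f x 1.

Lemma diff_orderP n f :
  diff_order n f <-> forall k x, (k <= n)%N -> derivable (derive1n k f) x 1.
Proof.
elim: n f => [|n IH] f /=.
  by split=> [df [|//] x _|df x]; [exact: df|exact: (df 0%N)].
split=> [[df [fdf ndf]] [|k] x|df].
- by move=> _; exact: ex_derive.
- rewrite ltnS => kn; rewrite derive1Sn.
  suff -> : derive1 f = df by exact: (IH df).1.
  by apply/funext => y; rewrite derive1E; exact: derive_val.
- exists (derive1 f); split.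
    by move=> x; rewrite derive1E; apply/derivableP; exact: (df 0%N).
  by apply/IH => k x kn; rewrite -derive1Sn; exact: df.
Qed.

Lemma smoothP f :
  (forall n x, derivable (derive1n n f) x 1) <-> (forall n, diff_order n f).
Proof.
split=> [df n|df n x]; first by apply/diff_orderP => k x _; exact: df.
by move/diff_orderP : (df n); apply.
Qed.

Lemma diff_order_le n f : diff_order n.+1 f -> diff_order n f.
Proof.
by move=> /diff_orderP df; apply/diff_orderP => k x kn; apply: df; exact: ltnW.
Qed.

Lemma diff_orderD n f g :
  diff_order n f -> diff_order n g -> diff_order n (fun x => f x + g x).
Proof.
elim: n f g => [|n IH] f g /=.
  by move=> df dg x; exact: derivableD.
move=> [df [fdf ndf]] [dg [gdg ndg]]; exists (fun x => df x + dg x).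
by split; [move=> x; exact: is_deriveD|exact: IH].
Qed.

Lemma diff_orderM n f g :
  diff_order n f -> diff_order n g -> diff_order n (fun x => f x * g x).
Proof.
elim: n f g => [|n IH] f g.
  by move=> df dg x; exact: derivableM.
move=> nf ng; have nf' := diff_order_le nf; have ng' := diff_order_le ng.
move: nf ng => [df [fdf ndf]] [dg [gdg ndg]].
exists (fun x => f x * dg x + g x * df x); split.
  by move=> x; exact: is_deriveM.
by apply: diff_orderD; exact: IH.
Qed.

Lemma diff_order_cst n (c : R) : diff_order n (fun=> c).
Proof.
elim: n c => [|n IH] c /=; first by move=> x; exact: derivable_cst.
by exists (fun=> 0); split => // x; exact: is_derive_cst.
Qed.

Lemma diff_order_affine n f (c d : R) :
  diff_order n f -> diff_order n (fun x => f (c * x + d)).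
Proof.
have aff x : is_derive x (1 : R) (fun x => c * x + d) c.
  apply: is_derive_eq.
  by rewrite addr0 [_ *: _]mulr1.
elim: n f => [|n IH] f /=.
  move=> df x; apply: ex_derive; apply: is_derive1_comp.
  by apply/derivableP; exact: df.
move=> [df [fdf ndf]]; exists (fun x => c * df (c * x + d)); split.
  by move=> x; rewrite mulrC; exact: is_derive1_comp.
by apply: diff_orderM; [exact: diff_order_cst|exact: IH].
Qed.

(** The family x^-k exp(- 1 / x), extended by 0 to x <= 0. Its derivatives are
    linear combinations of its members, so all members can be shown to be
    smooth by a simultaneous induction. *)
Definition flat_exp (k : nat) (x : R) : R :=
  if 0 < x then x^-1 ^+ k * expR (- x^-1) else 0.

(** With y = 1 / x this is y^(k + 2) / (k + 2)! <= exp y. *)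
Lemma flat_exp_le_sqr k x : `|flat_exp k x| <= k.+2`!%:R * x ^+ 2.
Proof.
rewrite /flat_exp; case: ifPn => [x0|_]; last first.
  by rewrite normr0 mulr_ge0// sqr_ge0.
have y0 : 0 < x^-1 by rewrite invr_gt0.
rewrite ger0_norm; last by rewrite mulr_ge0 ?expR_ge0 ?exprn_ge0// ltW.
rewrite expRN.
rewrite ler_pdivrMr ?expR_gt0// mulrAC.
have : x^-1 ^+ k.+2 <= k.+2`!%:R * expR x^-1.
  have : x^-1 ^+ k.+2 / k.+2`!%:R <= expR x^-1.
    by rewrite (le_trans _ (expR_ge1Dxn k.+1 (ltW y0)))// lerDr.
  by rewrite ler_pdivrMr ?ltr0n ?fact_gt0// mulrC.
rewrite -(@ler_pM2r _ (x ^+ 2)) ?exprn_gt0//; congr (_ <= _).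
by rewrite -addn2 exprD -mulrA -exprMn mulVf ?gt_eqF// expr1n mulr1.
Qed.

Lemma is_derive_sqr_bound f C : (forall x, `|f x| <= C * x ^+ 2) ->
  is_derive (0 : R) (1 : R) f 0.
Proof.
move=> fC.
have f0 : f 0 = 0.
  by apply/normr0_eq0/le_anti; rewrite normr_ge0 andbT (le_trans (fC 0))// expr0n mulr0.
have C0 : 0 <= C by have := le_trans (normr_ge0 _) (fC 1); rewrite expr1n mulr1.
have C1 e : 0 < e -> 0 < e / (C + 1) by move=> e0; rewrite divr_gt0// ltr_wpDl.
have lim0 : h^-1 *: (f (h *: (1 : R) + 0) - f 0) @[h --> 0^'] --> (0 : R).
  apply/cvgrPdist_le => e e0; have eC := C1 _ e0; near=> h.
  have h0 : h != 0 by near: h; exact: nbhs_dnbhs_neq.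
  rewrite sub0r normrN f0 subr0 addr0 [_ *: 1]mulr1 normrM normfV.
  rewrite ler_pdivrMl ?normr_gt0//.
  have : `|h| <= e / (C + 1) by near: h; exact: dnbhs0_le.
  rewrite ler_pdivlMr ?ltr_wpDl// => hC.
  rewrite (le_trans (fC h))// -real_normK ?num_real// expr2 mulrCA.
  rewrite ler_wpM2l// (le_trans _ hC)// mulrC ler_wpM2l// lerDl//.
apply: DeriveDef; last exact/cvg_lim.
by apply/cvg_ex; exists 0.
Unshelve. all: by end_near. Qed.

Lemma is_derive_flat_exp k x :
  is_derive x (1 : R) (flat_exp k) (- k%:R * flat_exp k.+1 x + flat_exp k.+2 x).
Proof.
have [x0|x0|<-] := ltgtP 0 x.
- apply: (@near_eq_is_derive R R R (fun y => y^-1 ^+ k * expR (- y^-1))).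
    near=> y; rewrite /flat_exp ifT//; near: y; exact: lt_nbhsr.
  have dV : is_derive x (1 : R) (fun y => y^-1) (- x ^- 2).
    apply: is_derive_eq; first by apply: is_deriveV; rewrite ?gt_eqF//.
    by rewrite [_ *: _]mulr1.
  have dE : is_derive x (1 : R) (fun y => expR (- y^-1)) (expR (- x^-1) * x ^- 2).
    have dN : is_derive x (1 : R) (fun y => - y^-1) (x ^- 2).
      by apply: is_derive_eq; rewrite opprK.
    exact: (@is_derive1_comp _ expR).
  have dX : is_derive x (1 : R) (fun y => y^-1 ^+ k) (k%:R * x^-1 ^+ k.-1 * - x ^- 2).
    by have := is_deriveX k dV; rewrite exprfctE.
  have dM := is_deriveM dX dE.
  apply: is_derive_eq.
  rewrite /flat_exp x0 /= /GRing.scale/=.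
  case: (k) => [|m]; first by rewrite mulr0n oppr0 !expr0 !mul0r !mulr0 mul1r addr0 add0r mulrC exprVn.
  rewrite -!exprVn/= !exprS. ring.
- apply: (@near_eq_is_derive R R R (cst 0)).
    near=> y; rewrite /flat_exp ifF//; apply/negbTE; rewrite -leNgt ltW//.
    near: y; exact: lt_nbhsl.
  by rewrite /flat_exp !ifF ?mulr0 ?addr0; [exact: is_derive_cst|exact: lt_gtF..].
- rewrite {2 3}/flat_exp ltxx mulr0 addr0.
  exact: (is_derive_sqr_bound (flat_exp_le_sqr k)).
Unshelve. all: by end_near. Qed.

Lemma diff_order_flat_exp n k : diff_order n (flat_exp k).
Proof.
elim: n k => [|n IH] k /=.
  by move=> x; apply: ex_derive; exact: is_derive_flat_exp.
exists (fun x => - k%:R * flat_exp k.+1 x + flat_exp k.+2 x).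
split; first exact: is_derive_flat_exp.
by apply: diff_orderD => //; apply: diff_orderM => //; exact: diff_order_cst.
Qed.

End Smooth.

(** * Test functions and the du Bois-Reymond lemma *)

Section TestFunctions.
Context {R : realType}.
Local Notation mu := (@lebesgue_measure R).
Implicit Types f g h phi psi : R -> R.

Definition bounded_support phi := exists M : R, forall x, M < `|x| -> phi x = 0.

Lemma testP phi : test_function phi <->
  (forall n, diff_order n phi) /\ bounded_support phi.
Proof.
rewrite /test_function smoothP; split=> -[dphi sphi]; split=> //.
  have [M [_ bM]] := compact_bounded sphi.
  exists (M + 1) => x Mx; apply/eqP; apply: contraTT Mx => phix.
  rewrite -leNgt; apply: (bM (M + 1)); first by rewrite ltrDl.
  exact: subset_closure.
have [M phi0] := sphi.
apply: (@subclosed_compact _ _ `[- M, M]); first exact: closed_closure.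
  exact: segment_compact.
rewrite [X in _ `<=` X](@closure_id _ _).1; last exact: itv_closed.
apply: closure_subset => x /= phix; rewrite in_itv/= -ler_norml leNgt.
by apply/negP => /phi0/eqP; rewrite (negbTE phix).
Qed.

Lemma test_is_derive phi x : test_function phi ->
  is_derive x (1 : R) phi (derive1 phi x).
Proof. by move=> [dphi _]; rewrite derive1E; apply/derivableP/(dphi 0%N). Qed.

Lemma test_continuous phi : test_function phi -> continuous phi.
Proof.
move=> tphi x; apply/differentiable_continuous/derivable1_diffP.
by case: (test_is_derive x tphi).
Qed.

Lemma test_derive1 phi : test_function phi -> test_function (derive1 phi).
Proof.
move=> tphi; have [dphi _] := tphi.
apply/testP; split; first by apply/smoothP => n x; rewrite -derive1Sn.
have /testP[_ [M phi0]] := tphi; exists M => x Mx.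
rewrite derive1E (@near_eq_derive R R R phi (cst 0)) ?derive_cst//.
near=> y; apply: phi0; near: y; apply: (@cvgr_gt _ _ _ _ _ `|x|) => //.
exact: norm_continuous.
Unshelve. all: by end_near. Qed.

Lemma continuous_bounded_support_integrable f : continuous f ->
  bounded_support f -> mu.-integrable setT (EFin \o f).
Proof.
move=> cf [M f0].
have <- : f \_ `[- M, M] = f.
  apply/funext => x; rewrite patchE; case: ifPn => // xM.
  apply/esym/f0; rewrite ltNge; apply: contra xM => xM.
  by rewrite inE/= in_itv/= -ler_norml.
rewrite -restrict_EFin -integrable_mkcond//.
apply: continuous_compact_integrable; first exact: segment_compact.
exact: continuous_subspaceT.
Qed.

Lemma continuous_bounded_support_L2 f : continuous f ->
  bounded_support f -> L2 f.
Proof.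
move=> cf [M f0]; apply/L2P; split; first exact: continuous_measurable_fun.
apply: continuous_bounded_support_integrable; last first.
  by exists M => x Mx; rewrite f0// expr0n.
by move=> x; rewrite /continuous_at; apply: cvgM; exact: cf.
Qed.

Lemma test_L2 phi : test_function phi -> L2 phi.
Proof.
move=> tphi; apply: continuous_bounded_support_L2; first exact: test_continuous.
by have /testP[] := tphi.
Qed.

(** A test function supported in [a, b] that increases with n to the indicator
    function of ]a, b[: each factor is exp(- 1 / ((n + 1) y)) on y > 0, and 0
    elsewhere. *)
Definition bump (a b : R) (n : nat) (x : R) : R :=
  flat_exp 0 (n.+1%:R * (x - a)) * flat_exp 0 (n.+1%:R * (b - x)).

Lemma test_bump a b n : test_function (bump a b n).
Proof.
apply/testP; split=> [m|].
  apply: diff_orderM.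
    have -> : (fun x => flat_exp 0 (n.+1%:R * (x - a))) =
              (fun x => flat_exp 0 (n.+1%:R * x + - (n.+1%:R * a))).
      by apply/funext => x; rewrite mulrBr.
    by apply: diff_order_affine; exact: diff_order_flat_exp.
  have -> : (fun x => flat_exp 0 (n.+1%:R * (b - x))) =
            (fun x => flat_exp 0 (- n.+1%:R * x + n.+1%:R * b)).
    by apply/funext => x; rewrite mulrBr mulNr addrC.
  by apply: diff_order_affine; exact: diff_order_flat_exp.
exists (`|a| + `|b|) => x abx; rewrite /bump /flat_exp !pmulr_rgt0// !subr_gt0.
case: ifPn => [ax|_]; last by rewrite mul0r.
case: ifPn => [xb|_]; last by rewrite mulr0.
have : `|x| <= `|a| + `|b|.
  have := ler_norm b; have := ler_normlW (lexx `|- a|); rewrite normrN => aa bb.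
  have := normr_ge0 a; have := normr_ge0 b => b0 a0.
  by rewrite ler_norml; apply/andP; split; lra.
by rewrite leNgt abx.
Qed.

Lemma bump_le a b n x : `|bump a b n x| <= \1_(`]a, b[) x.
Proof.
rewrite /bump /flat_exp !pmulr_rgt0// !subr_gt0 indicE mem_setE in_itv/=.
case: ifPn => [ax|_]; last by rewrite mul0r normr0.
case: ifPn => [xb|_]; last by rewrite mulr0 normr0.
rewrite !expr0 !mul1r ger0_norm ?mulr_ge0 ?expR_ge0//.
by rewrite mulr_ile1 ?expR_ge0// -expR0 ler_expR oppr_le0 invr_ge0 mulr_ge0// subr_ge0 ltW.
Qed.

Lemma bump_cvg a b x : bump a b n x @[n --> \oo] --> (\1_(`]a, b[) x : R).
Proof.
rewrite /bump /flat_exp indicE mem_setE in_itv/=.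
under eq_fun do rewrite !pmulr_rgt0// !subr_gt0.
have [ax|_] := ltP a x; last by under eq_fun do rewrite mul0r; exact: cvg_cst.
have [xb|_] := ltP x b; last by under eq_fun do rewrite mulr0; exact: cvg_cst.
have e1 (y : R) : 0 < y -> expR (- (n.+1%:R * y)^-1) @[n --> \oo] --> (1 : R).
  move=> y0; rewrite -[X in _ --> X]expR0.
  apply: continuous_cvg; first exact: continuous_expR.
  under eq_fun do rewrite invfM -mulNr.
  rewrite -(mul0r y^-1); apply: cvgMl; rewrite -oppr0; apply: cvgN.
  exact: cvg_harmonic.
under eq_fun do rewrite !expr0 !mul1r.
have ax0 : 0 < x - a by rewrite subr_gt0.
have xb0 : 0 < b - x by rewrite subr_gt0.
by have := cvgM (e1 _ ax0) (e1 _ xb0); rewrite mulr1; exact.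
Qed.

Lemma indic_L2 (a b : R) : L2 (\1_(`]a, b[) : R -> R).
Proof.
apply/L2P; split; first exact: measurable_indic.
have := integrable_indic_itv a b false true.
by apply: eq_integrable => // x _ /=; rewrite indicE -natrX; case: (_ \in _).
Qed.

Lemma L2_integrable_itv h a b : L2 h -> mu.-integrable `]a, b[ (EFin \o h).
Proof.
move=> Lh; rewrite integrable_mkcond//.
have := L2M_integrable Lh (indic_L2 a b).
apply: eq_integrable => // x _; rewrite restrict_EFin/= patchE indicE.
by case: ifPn => _; rewrite ?mulr1 ?mulr0.
Qed.

Lemma L2_integrable_bounded h (A : set R) (M : R) : L2 h -> measurable A ->
  (forall x, A x -> `|x| <= M) -> mu.-integrable A (EFin \o h).
Proof.
move=> Lh mA AM.
apply: (integrableS _ _ _ (L2_integrable_itv (- (M + 1)) (M + 1) Lh)) => //.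
move=> x Ax; rewrite /= in_itv/= -ltr_norml.
by rewrite (le_lt_trans (AM _ Ax))// ltrDl.
Qed.

Lemma L2_locally_integrable h : L2 h -> locally_integrable setT h.
Proof.
move=> Lh; split; [exact: L2_measurable|exact: openT|move=> K _ cK].
have [M [_ bM]] := compact_bounded cK.
have : mu.-integrable K (EFin \o h).
  apply: (@L2_integrable_bounded _ _ (M + 1)) => //.
    exact: compact_measurable.
  by apply: (bM (M + 1)); rewrite ltrDl.
by move/integrableP => [].
Qed.

(** Dominated convergence along the bumps of ]a, b[. *)
Lemma ip_indic0 h a b : L2 h ->
  (forall phi, test_function phi -> ip h phi = 0) -> ip h \1_(`]a, b[) = 0.
Proof.
move=> Lh h0.
have Lb n := test_L2 (test_bump a b n).
pose f_ n x := (h x * bump a b n x)%:E.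
pose f x := (h x * \1_(`]a, b[) x)%:E.
have intf := L2M_integrable Lh (indic_L2 a b).
have : (\int[mu]_x f_ n x)%E @[n --> \oo] --> (\int[mu]_x f x)%E.
  have [] // := @dominated_convergence _ _ _ mu setT measurableT f_ f (abse \o f).
  - by move=> n; exact: measurable_int (L2M_integrable Lh (Lb n)).
  - exact: measurable_int intf.
  - apply: aeW => x _; apply: cvg_EFin; first exact: nearW.
    by apply: cvgMr; exact: bump_cvg.
  - exact: integrable_abse.
  - apply: aeW => x n _; rewrite /f_ /f/= lee_fin !(normrM (h x)) ler_wpM2l//.
    exact: (le_trans (bump_le a b n x)) (ler_norm _).
rewrite -(EFin_ip Lh (indic_L2 a b)) => /fine_cvg.
rewrite (_ : _ \o _ = cst 0); last first.
  by apply/funext => n; rewrite /= -EFin_ip//= h0//; exact: test_bump.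
by move=> /(cvg_lim (@Rhausdorff R))/esym ->; rewrite lim_cst.
Qed.

(** The integral of h over every interval vanishes, so the claim follows from
    the Lebesgue differentiation theorem on each ]-n, +oo[. *)
Lemma du_Bois_Reymond h : L2 h ->
  (forall phi, test_function phi -> ip h phi = 0) ->
  {ae mu, forall x, h x = 0}.
Proof.
move=> Lh h0.
have int_itv (a b : R) : mu.-integrable `]a, b] (EFin \o h).
  apply: (@L2_integrable_bounded _ _ (`|a| + `|b|)) => // x /=.
  rewrite in_itv/= => /andP[ax xb].
  have := ler_norm b; have := ler_normlW (lexx `|- a|); rewrite normrN => aa bb.
  have := normr_ge0 a; have := normr_ge0 b => b0 a0.
  by rewrite ler_norml; apply/andP; split; lra.
have int0 (a b : R) : \int[mu]_(x in `]a, b]) h x = 0.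
  rewrite -Rintegral_itv_bndo_bndc; last exact: L2_integrable_itv.
  rewrite Rintegral_mkcond -[RHS](ip_indic0 a b Lh h0) ip.unlock.
  apply: eq_Rintegral => x _; rewrite patchE indicE.
  by case: ifPn => _; rewrite ?mulr1 ?mulr0.
have : {ae mu, forall x, forall n : nat, - n%:R < x -> h x = 0}.
  apply/ae_foralln => n.
  have := @FTC1 R h (BRight (- n%:R)) (int_itv _) (L2_locally_integrable Lh).
  have -> : (fun x : R => (\int[mu]_(t in `](- n%:R), x]) (h t))%R) = cst 0.
    by apply/funext => x; rewrite int0.
  apply: filterS; first exact: (ae_filter_ringOfSetsType mu).
  by move=> x /= + nx; rewrite lte_fin nx derive1_cst => /(_ isT)[_ <-].
apply: filterS; first exact: (ae_filter_ringOfSetsType mu).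
move=> x /(_ (Num.truncn `|x|).+1); apply.
by rewrite ltrNl (le_lt_trans _ (truncnS_gt _))// -normrN ler_norm.
Qed.

End TestFunctions.

(** * Exponential integrals and iterated integrals *)

Section ExpIntegrals.
Context {R : realType}.
Local Notation mu := (@lebesgue_measure R).

Lemma ge0_integral_itv_expR (c a : R) : 0 < c ->
  (\int[mu]_(x in `[a, +oo[) (expR (- (c * (x - a))))%:E = (c^-1)%:E)%E.
Proof.
move=> c0.
pose F (x : R) := - c^-1 * expR (- (c * (x - a))).
have dF (x : R) : is_derive x 1 F (expR (- (c * (x - a)))).
  have dl : is_derive x 1 (fun x : R => - (c * (x - a))) (- c).
    apply: is_derive_eq.
    by rewrite subr0 [_ *: _]mulr1.
  have := is_deriveZ (- c^-1) (is_derive1_comp (is_derive_expR _) dl).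
  move=> dE; apply: is_derive_eq.
  by rewrite /GRing.scale/= mulrCA mulrNN mulVf ?gt_eqF// mulr1.
have cF : continuous F.
  by move=> x; apply/differentiable_continuous/derivable1_diffP; case: (dF x).
rewrite (@ge0_continuous_FTC2y _ _ F _ 0).
- by rewrite /F subrr mulr0 oppr0 expR0 mulr1 sub0e EFinN oppeK.
- by move=> x _; exact: expR_ge0.
- apply: continuous_subspaceT => x.
  apply: continuous_comp; last exact: continuous_expR.
  apply: cvgN; apply: cvgMr; apply: cvgB => //; exact: cvg_cst.
- rewrite -(mulr0 (- c^-1)); apply: cvgMr.
  apply: (@cvg_comp _ _ _ (fun x => c * (x - a)) (fun x => expR (- x)) _ +oo).
    apply: gt0_cvgMry => //; exact: cvg_addrr.
  exact: cvgr_expR.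
- by move=> x _; case: (dF x).
- by apply: cvg_at_right_filter; exact: cF.
- by move=> x _; rewrite derive1E; apply: derive_val.
Qed.

Lemma ge0_integral_opp (f : R -> \bar R) : measurable_fun setT f ->
  (forall x, 0 <= f x)%E -> (\int[mu]_x f (- x)%R = \int[mu]_x f x)%E.
Proof.
move=> mf f0.
have -> : (\int[mu]_x f x = \int[pushforward mu (-%R : _ -> measurableTypeR R)]_x f x)%E.
  by apply: eq_measure_integral => //= A mA _; exact/esym/lebesgue_measureN.
by rewrite ge0_integral_pushforward.
Qed.

Lemma ge0_tonelli (F : R -> R -> R) :
  measurable_fun setT (fun p : R * R => F p.1 p.2) ->
  (forall x y, 0 <= F x y) ->
  (\int[mu]_x \int[mu]_y (F x y)%:E = \int[mu]_y \int[mu]_x (F x y)%:E)%E.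
Proof.
move=> mF F0.
apply: (@fubini_tonelli _ _ _ _ _ mu mu (fun p : R * R => (F p.1 p.2)%:E)).
  exact/measurable_EFinP.
by move=> p; rewrite lee_fin.
Qed.

Lemma measurable_ge0_integral (F : R -> R -> R) :
  measurable_fun setT (fun p : R * R => F p.1 p.2) ->
  (forall x y, 0 <= F x y) ->
  measurable_fun setT (fun x => \int[mu]_y (F x y)%:E)%E.
Proof.
move=> mF F0.
apply: (@measurable_fun_fubini_tonelli_F _ _ _ _ _ mu
  (fun p : R * R => (F p.1 p.2)%:E)); first exact/measurable_EFinP.
by move=> p; rewrite lee_fin.
Qed.

Lemma measurable_EFin_section (F : R -> R -> R) x :
  measurable_fun setT (fun p : R * R => F p.1 p.2) ->
  measurable_fun setT (fun y => (F x y)%:E).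
Proof.
by move=> mF; apply/measurable_EFinP; have := measurable_fun_pair2 x mF.
Qed.

End ExpIntegrals.

(** * The resolvent of the derivative *)

Section Resolvent.
Context {R : realType}.
Local Notation mu := (@lebesgue_measure R).
Variable e : R.
Hypothesis e0 : 0 < e.
Implicit Types f g h phi psi : R -> R.

Definition exp_ker (z x : R) : R := if x <= z then expR (- (e * (z - x))) else 0.

(** The operator (d/dx + e)^-1. *)
Definition resolvent f (z : R) : R := ip (exp_ker z) f.

Lemma exp_ker_ge0 z x : 0 <= exp_ker z x.
Proof. by rewrite /exp_ker; case: ifP => // _; exact: expR_ge0. Qed.

Lemma exp_ker_le1 z x : exp_ker z x <= 1.
Proof.
rewrite /exp_ker; case: ifP => // xz.
by rewrite -expR0 ler_expR oppr_le0 mulr_ge0 ?subr_ge0// ltW.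
Qed.

Lemma measurable_exp_ker : measurable_fun setT (fun p : R * R => exp_ker p.1 p.2).
Proof.
apply: measurable_fun_ifT => //; first exact: measurable_fun_ler.
apply: measurableT_comp => //; apply: measurableT_comp => //.
by apply: measurable_funM => //; exact: measurable_funB.
Qed.

Lemma measurable_exp_ker1 z : measurable_fun setT (exp_ker z).
Proof. by have := measurable_fun_pair2 z measurable_exp_ker. Qed.

Lemma measurable_exp_ker2 x : measurable_fun setT (exp_ker ^~ x).
Proof. by have := measurable_fun_pair1 x measurable_exp_ker. Qed.

Lemma integral_exp_ker2 x : (\int[mu]_z (exp_ker z x)%:E = (e^-1)%:E)%E.
Proof.
rewrite -(ge0_integral_itv_expR x e0) [RHS]integral_mkcond.
apply: eq_integral => z _; rewrite patchE /exp_ker mem_setE in_itv/= andbT.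
by case: ifP.
Qed.

Lemma exp_ker_opp z x : exp_ker (- x) (- z) = exp_ker z x.
Proof. by rewrite /exp_ker lerN2 opprK addrC. Qed.

Lemma integral_exp_ker1 z : (\int[mu]_x (exp_ker z x)%:E = (e^-1)%:E)%E.
Proof.
rewrite -(integral_exp_ker2 (- z)) -[RHS]ge0_integral_opp.
- by apply: eq_integral => x _; rewrite exp_ker_opp.
- by apply/measurable_EFinP; exact: measurable_exp_ker2.
- by move=> x; rewrite lee_fin exp_ker_ge0.
Qed.

Lemma exp_ker_L2 z : L2 (exp_ker z).
Proof.
have mk := measurable_exp_ker1 z.
apply/L2P; split => //; apply: (@le_integrable _ _ _ mu setT _ _ (EFin \o exp_ker z)) => //.
- by apply/measurable_EFinP; exact: measurable_funX.
- move=> x _; rewrite /= lee_fin !ger0_norm ?sqr_ge0 ?exp_ker_ge0//.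
  by rewrite expr2 ler_piMr ?exp_ker_ge0 ?exp_ker_le1.
- apply/integrableP; split; first exact/measurable_EFinP.
  under eq_integral do rewrite gee0_abs ?lee_fin ?exp_ker_ge0//.
  by rewrite /= integral_exp_ker1 ltry.
Qed.

Local Notation K := resolvent.

Lemma resolventE f z : L2 f -> (K f z)%:E = (\int[mu]_x (exp_ker z x * f x)%:E)%E.
Proof. by move=> Lf; rewrite -EFin_ip//; exact: exp_ker_L2. Qed.

Lemma resolvent_ge0 f z : (forall x, 0 <= f x) -> 0 <= K f z.
Proof. by move=> f0; rewrite /resolvent ip.unlock; apply: Rintegral_ge0 => x _; rewrite mulr_ge0 ?exp_ker_ge0. Qed.

Lemma resolventB f g : L2 f -> L2 g -> K (fun x => f x - g x) = (fun z => K f z - K g z).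
Proof. by move=> Lf Lg; apply/funext => z; apply: ipBr => //; exact: exp_ker_L2. Qed.

Lemma resolventZ c f : L2 f -> K (fun x => c * f x) = (fun z => c * K f z).
Proof. by move=> Lf; apply/funext => z; apply: ipZr => //; exact: exp_ker_L2. Qed.

(** The equality holds pointwise because resolvent f z is an inner product. *)
Lemma eq_resolvent f g : L2 f -> L2 g -> {ae mu, forall x, f x = g x} -> K f = K g.
Proof.
move=> Lf Lg fg; apply/funext => z; apply: (eq_ip (exp_ker_L2 z) (exp_ker_L2 z)) => //.
exact: aeW.
Qed.

(** The Green function of e^2 - d^2/dx^2, that is, the kernel of K^* K. *)
Definition green (x y : R) : R := expR (- (e * `|x - y|)) / (2 * e).

Lemma green_ge0 x y : 0 <= green x y.
Proof. by rewrite mulr_ge0 ?expR_ge0// invr_ge0 mulr_ge0// ltW. Qed.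

Lemma measurable_green : measurable_fun setT (fun p : R * R => green p.1 p.2).
Proof.
apply: measurable_funM => //; apply: measurableT_comp => //.
apply: measurableT_comp => //; apply: measurable_funM => //.
by apply: measurableT_comp => //; exact: measurable_funB.
Qed.

Lemma integral_exp_kerM x y :
  (\int[mu]_z (exp_ker z x * exp_ker z y)%:E = (green x y)%:E)%E.
Proof.
wlog xy : x y / x <= y.
  move=> H; have [|/ltW yx] := leP x y; first exact: H.
  have -> : green x y = green y x by rewrite /green distrC.
  rewrite -(H y x yx).
  by apply: eq_integral => z _; rewrite mulrC.
transitivity (\int[mu]_(z in `[y, +oo[)
    ((expR (- (e * (y - x))))%:E * (expR (- (2 * e * (z - y))))%:E))%E.
  rewrite [RHS]integral_mkcond.
  apply: eq_integral => z _; rewrite patchE /exp_ker mem_setE in_itv/= andbT.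
  have [yz|_] := leP y z; last by rewrite mulr0.
  by rewrite (le_trans xy yz) -!EFinM -!expRD; congr (expR _)%:E; ring.
rewrite ge0_integralZl//; last first.
  apply: measurable_funTS; apply/measurable_EFinP; apply: measurableT_comp => //.
  apply: measurableT_comp => //; apply: measurable_funM => //.
  exact: measurable_funB.
rewrite ge0_integral_itv_expR ?mulr_gt0// -EFinM /green distrC ger0_norm//.
by rewrite subr_ge0.
Qed.

(** K + K^* = 2 e K^* K for the kernels, away from the diagonal where the left
    hand side jumps. *)
Lemma exp_kerD x y : x != y -> exp_ker x y + exp_ker y x = 2 * e * green x y.
Proof.
move=> xy; rewrite /green mulrC divfK ?mulf_neq0 ?pnatr_eq0 ?(gt_eqF e0)//.
rewrite /exp_ker; have [xy'|yx|xy'] := ltgtP x y; last by rewrite xy' eqxx in xy.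
- by rewrite add0r ltr0_norm ?subr_lt0// opprB.
- by rewrite addr0 gtr0_norm ?subr_gt0.
Qed.

Lemma measurable_resolvent f : L2 f -> measurable_fun setT (K f).
Proof.
move: f; apply: L2_ind => [f Lf f0|f g Lf Lg mKf mKg]; last first.
  by rewrite resolventB//; exact: measurable_funB.
apply/measurable_EFinP.
rewrite (_ : _ \o _ = fun z => (\int[mu]_x (exp_ker z x * f x)%:E)%E); last first.
  by apply/funext => z; rewrite /= resolventE.
apply: measurable_ge0_integral => [|x y]; last by rewrite mulr_ge0// exp_ker_ge0.
apply: measurable_funM; first exact: measurable_exp_ker.
by apply: measurableT_comp => //; exact: L2_measurable.
Qed.

Section Ge0.
Variables f g : R -> R.
Hypotheses (Lf : L2 f) (Lg : L2 g).
Hypotheses (f0 : forall x, 0 <= f x) (g0 : forall x, 0 <= g x).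

Let mf2 : measurable_fun setT (fun p : R * R => f p.2).
Proof. by apply: measurableT_comp => //; exact: L2_measurable. Qed.
Let mg2 : measurable_fun setT (fun p : R * R => g p.2).
Proof. by apply: measurableT_comp => //; exact: L2_measurable. Qed.

Lemma integral_mul_resolvent :
  (\int[mu]_x (f x * K g x)%:E = \int[mu]_x \int[mu]_y (f x * g y * exp_ker x y)%:E)%E.
Proof.
apply: eq_integral => x _; rewrite EFinM resolventE// -ge0_integralZl//.
- by apply: eq_integral => y _; rewrite -EFinM; congr _%:E; ring.
- apply/measurable_EFinP; apply: measurable_funM; first exact: measurable_exp_ker1.
  exact: L2_measurable.
- by move=> y _; rewrite lee_fin mulr_ge0// exp_ker_ge0.
- by rewrite lee_fin.
Qed.

Lemma integral_exp_ker_resolvent x :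
  (\int[mu]_z (exp_ker z x * K g z)%:E = \int[mu]_y (g y * green x y)%:E)%E.
Proof.
transitivity (\int[mu]_z \int[mu]_y (exp_ker z x * exp_ker z y * g y)%:E)%E.
  apply: eq_integral => z _; rewrite EFinM resolventE// -ge0_integralZl//.
  - by apply: eq_integral => y _; rewrite -EFinM mulrA.
  - apply/measurable_EFinP; apply: measurable_funM; first exact: measurable_exp_ker1.
    exact: L2_measurable.
  - by move=> y _; rewrite lee_fin mulr_ge0// exp_ker_ge0.
  - by rewrite lee_fin exp_ker_ge0.
rewrite ge0_tonelli; first last.
- by move=> z y; rewrite !mulr_ge0// exp_ker_ge0.
- apply: measurable_funM => //; apply: measurable_funM; last exact: measurable_exp_ker.
  by apply: (measurableT_comp (measurable_exp_ker2 x)).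
apply: eq_integral => y _; rewrite EFinM -integral_exp_kerM -ge0_integralZl//.
- by apply: eq_integral => z _; rewrite -EFinM mulrC.
- by apply/measurable_EFinP; apply: measurable_funM; exact: measurable_exp_ker2.
- by move=> z _; rewrite lee_fin mulr_ge0// exp_ker_ge0.
- by rewrite lee_fin.
Qed.

Lemma integral_resolventM :
  (\int[mu]_z (K f z * K g z)%:E =
   \int[mu]_x \int[mu]_y (f x * g y * green x y)%:E)%E.
Proof.
have Kg0 z : 0 <= K g z by exact: resolvent_ge0.
transitivity (\int[mu]_z \int[mu]_x (exp_ker z x * f x * K g z)%:E)%E.
  apply: eq_integral => z _; rewrite EFinM resolventE// -ge0_integralZr//.
  - apply/measurable_EFinP; apply: measurable_funM; first exact: measurable_exp_ker1.
    exact: L2_measurable.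
  - by move=> y _; rewrite lee_fin mulr_ge0// exp_ker_ge0.
  - by rewrite lee_fin.
rewrite ge0_tonelli; first last.
- by move=> z y; rewrite !mulr_ge0// exp_ker_ge0.
- apply: measurable_funM; first by apply: measurable_funM => //; exact: measurable_exp_ker.
  by apply: measurableT_comp => //; exact: measurable_resolvent.
apply: eq_integral => x _.
transitivity ((f x)%:E * \int[mu]_z (exp_ker z x * K g z)%:E)%E.
  rewrite -ge0_integralZl//.
  - by apply: eq_integral => z _; rewrite -EFinM; congr _%:E; ring.
  - by apply/measurable_EFinP; apply: measurable_funM; [exact: measurable_exp_ker2|exact: measurable_resolvent].
  - by move=> z _; rewrite lee_fin mulr_ge0// exp_ker_ge0.
  - by rewrite lee_fin.
rewrite integral_exp_ker_resolvent -ge0_integralZl//.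
- by apply: eq_integral => z _; rewrite -EFinM mulrA.
- apply/measurable_EFinP; apply: measurable_funM; first exact: L2_measurable.
  by have := measurable_fun_pair2 x measurable_green.
- by move=> z _; rewrite lee_fin mulr_ge0// green_ge0.
- by rewrite lee_fin.
Qed.

End Ge0.

(** All integrals are brought into the form of a double integral of f x * g y
    against a kernel, and then exp_kerD applies. The identity holds in [0, +oo]:
    it is used to show that resolvent f is in L^2. *)
Lemma ge0_resolvent_adjoint f g : L2 f -> L2 g ->
  (forall x, 0 <= f x) -> (forall x, 0 <= g x) ->
  (\int[mu]_x (f x * K g x)%:E + \int[mu]_x (g x * K f x)%:E =
   (2 * e)%:E * \int[mu]_x (K f x * K g x)%:E)%E.
Proof.
move=> Lf Lg f0 g0.
have mf := L2_measurable Lf; have mg := L2_measurable Lg.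
have mk1 : measurable_fun setT (fun p : R * R => exp_ker p.2 p.1).
  exact: (measurableT_comp measurable_exp_ker (@measurable_swap _ _ R R)).
have mfg : measurable_fun setT (fun p : R * R => f p.1 * g p.2).
  by apply: measurable_funM; apply: measurableT_comp.
have e20 : 0 <= 2 * e by rewrite mulr_ge0// ltW.
have mm1 : measurable_fun setT (fun p : R * R => f p.1 * g p.2 * exp_ker p.1 p.2).
  by apply: measurable_funM => //; exact: measurable_exp_ker.
have mm2 : measurable_fun setT (fun p : R * R => f p.1 * g p.2 * exp_ker p.2 p.1).
  exact: measurable_funM.
have mm3 : measurable_fun setT (fun p : R * R => f p.1 * g p.2 * green p.1 p.2).
  by apply: measurable_funM => //; exact: measurable_green.
rewrite integral_mul_resolvent// [X in (_ + X)%E]integral_mul_resolvent// integral_resolventM//.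
have -> : (\int[mu]_x \int[mu]_y (g x * f y * exp_ker x y)%:E =
           \int[mu]_x \int[mu]_y (f x * g y * exp_ker y x)%:E)%E.
  rewrite -ge0_tonelli; first last.
  - by move=> x y; rewrite !mulr_ge0// exp_ker_ge0.
  - apply: measurable_funM => //.
    by apply: measurable_funM; apply: measurableT_comp.
  by apply: eq_integral => x _; apply: eq_integral => y _; rewrite (mulrC (g y)).
have F10 x y : 0 <= f x * g y * exp_ker x y by rewrite !mulr_ge0// exp_ker_ge0.
have F20 x y : 0 <= f x * g y * exp_ker y x by rewrite !mulr_ge0// exp_ker_ge0.
have F30 x y : 0 <= f x * g y * green x y
  by apply: mulr_ge0; [exact: mulr_ge0|exact: green_ge0].
rewrite -ge0_integralD//; last first.
- exact: measurable_ge0_integral.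
- by move=> x _; apply: integral_ge0 => y _; rewrite lee_fin.
- exact: measurable_ge0_integral.
- by move=> x _; apply: integral_ge0 => y _; rewrite lee_fin.
rewrite -ge0_integralZl//; last first.
- by move=> x _; apply: integral_ge0 => y _; rewrite lee_fin.
- exact: measurable_ge0_integral.
apply: eq_integral => x _.
rewrite -ge0_integralD//; last first.
- exact: (@measurable_EFin_section _ (fun x y => f x * g y * exp_ker y x)).
- by move=> y _; rewrite lee_fin.
- exact: (@measurable_EFin_section _ (fun x y => f x * g y * exp_ker x y)).
- by move=> y _; rewrite lee_fin.
rewrite -ge0_integralZl//; last first.
- by move=> y _; rewrite lee_fin.
- exact: (@measurable_EFin_section _ (fun x y => f x * g y * green x y)).
apply: ae_eq_integral => //.
- apply: emeasurable_funD; first exact: (@measurable_EFin_section _ (fun x y => f x * g y * exp_ker x y)).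
  exact: (@measurable_EFin_section _ (fun x y => f x * g y * exp_ker y x)).
- by apply: measurable_funeM; exact: (@measurable_EFin_section _ (fun x y => f x * g y * green x y)).
exists [set x]; split => //; first exact: lebesgue_measure_set1.
move=> y /= /not_implyP[_ yx]; apply/eqP; apply: contra_notT yx => yx.
rewrite -EFinD -EFinM -mulrDr exp_kerD 1?eq_sym//; congr _%:E; ring.
Qed.

(** By ge0_resolvent_adjoint, 2 e ||K f||^2 is twice the double integral of
    f x * f y * exp_ker x y, and f x * f y <= f x ^+ 2 + f y ^+ 2. Both resulting
    integrals are finite since the kernel has integral 1 / e in each variable. *)
Lemma ge0_resolvent_L2 f : L2 f -> (forall x, 0 <= f x) -> L2 (K f).
Proof.
move=> Lf f0; apply/L2P; split; first exact: measurable_resolvent.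
have mK := measurable_resolvent Lf; have mf := L2_measurable Lf.
apply/integrableP; split; first by apply/measurable_EFinP; exact: measurable_funX.
under eq_integral do rewrite gee0_abs ?lee_fin ?sqr_ge0//.
rewrite /=.
have int2 : (\int[mu]_x (f x ^+ 2)%:E < +oo)%E.
  have /L2P[_ /integrableP[_]] := Lf.
  by under eq_integral do rewrite gee0_abs ?lee_fin ?sqr_ge0//.
have e20 : 0 < 2 * e by rewrite mulr_gt0.
suff : ((2 * e)%:E * \int[mu]_x (K f x ^+ 2)%:E < +oo)%E.
  move=> h; rewrite ltey; apply: contraTneq h => ->.
  by rewrite gt0_muley ?lte_fin// ltxx.
rewrite -(@ge0_resolvent_adjoint f f)// integral_mul_resolvent//.
have F0 x y : 0 <= f x ^+ 2 * exp_ker x y by rewrite mulr_ge0 ?sqr_ge0 ?exp_ker_ge0.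
have F1 x y : 0 <= f y ^+ 2 * exp_ker x y by rewrite mulr_ge0 ?sqr_ge0 ?exp_ker_ge0.
have m0 : measurable_fun setT (fun p : R * R => f p.1 * f p.2 * exp_ker p.1 p.2).
  apply: measurable_funM; last exact: measurable_exp_ker.
  by apply: measurable_funM; apply: measurableT_comp.
have m1 : measurable_fun setT (fun p : R * R => f p.1 ^+ 2 * exp_ker p.1 p.2).
  apply: measurable_funM; last exact: measurable_exp_ker.
  by apply: measurable_funX; apply: measurableT_comp.
have m2 : measurable_fun setT (fun p : R * R => f p.2 ^+ 2 * exp_ker p.1 p.2).
  apply: measurable_funM; last exact: measurable_exp_ker.
  by apply: measurable_funX; apply: measurableT_comp.
have F2 x y : 0 <= f x * f y * exp_ker x y by rewrite !mulr_ge0// exp_ker_ge0.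
have bound : (\int[mu]_x \int[mu]_y (f x * f y * exp_ker x y)%:E <=
    \int[mu]_x \int[mu]_y (f x ^+ 2 * exp_ker x y)%:E +
    \int[mu]_x \int[mu]_y (f y ^+ 2 * exp_ker x y)%:E)%E.
  rewrite -ge0_integralD//; last first.
  - exact: measurable_ge0_integral.
  - by move=> x _; apply: integral_ge0 => y _; rewrite lee_fin.
  - exact: measurable_ge0_integral.
  - by move=> x _; apply: integral_ge0 => y _; rewrite lee_fin.
  apply: ge0_le_integral => //.
  - by move=> x _; apply: integral_ge0 => y _; rewrite lee_fin.
  - exact: measurable_ge0_integral.
  - by apply: emeasurable_funD; exact: measurable_ge0_integral.
  move=> x _; rewrite -ge0_integralD//; last first.
  - exact: (@measurable_EFin_section _ (fun x y => f y ^+ 2 * exp_ker x y)).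
  - by move=> y _; rewrite lee_fin.
  - exact: (@measurable_EFin_section _ (fun x y => f x ^+ 2 * exp_ker x y)).
  - by move=> y _; rewrite lee_fin.
  apply: ge0_le_integral => //.
  - by move=> y _; rewrite lee_fin.
  - exact: (@measurable_EFin_section _ (fun x y => f x * f y * exp_ker x y)).
  - apply: emeasurable_funD; first exact: (@measurable_EFin_section _ (fun x y => f x ^+ 2 * exp_ker x y)).
    exact: (@measurable_EFin_section _ (fun x y => f y ^+ 2 * exp_ker x y)).
  - move=> y _; rewrite -EFinD lee_fin -mulrDl ler_wpM2r ?exp_ker_ge0//.
    have := sqr_ge0 (f x - f y); have := f0 x; have := f0 y; nra.
have fe : (\int[mu]_x ((f x ^+ 2)%:E * (e^-1)%:E) < +oo)%E.
  rewrite ge0_integralZr//.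
  - by rewrite muleC lte_mul_pinfty ?lee_fin ?invr_ge0 ?(ltW e0).
  - by apply/measurable_EFinP; exact: measurable_funX.
  - by move=> x _; rewrite lee_fin sqr_ge0.
  - by rewrite lee_fin invr_ge0 ltW.
have A : (\int[mu]_x \int[mu]_y (f x ^+ 2 * exp_ker x y)%:E < +oo)%E.
  apply: le_lt_trans fe; rewrite le_eqVlt; apply/orP; left; apply/eqP.
  apply: eq_integral => x _; rewrite -(integral_exp_ker1 x) -ge0_integralZl//.
  - by apply/measurable_EFinP; exact: measurable_exp_ker1.
  - by move=> y _; rewrite lee_fin exp_ker_ge0.
  - by rewrite lee_fin sqr_ge0.
have B : (\int[mu]_x \int[mu]_y (f y ^+ 2 * exp_ker x y)%:E < +oo)%E.
  apply: le_lt_trans fe; rewrite le_eqVlt; apply/orP; left; apply/eqP.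
  rewrite ge0_tonelli//.
  apply: eq_integral => x _; rewrite -(integral_exp_ker2 x) -ge0_integralZl//.
  - by apply/measurable_EFinP; exact: measurable_exp_ker2.
  - by move=> y _; rewrite lee_fin exp_ker_ge0.
  - by rewrite lee_fin sqr_ge0.
have C := le_lt_trans bound (lte_add_pinfty A B).
exact: (lte_add_pinfty C C).
Qed.

Lemma resolvent_L2 f : L2 f -> L2 (K f).
Proof.
move: f; apply: L2_ind => [f Lf f0|f g Lf Lg LKf LKg]; first exact: ge0_resolvent_L2.
by rewrite resolventB//; exact: L2B.
Qed.

Lemma resolvent_adjoint f g : L2 f -> L2 g ->
  ip f (K g) + ip g (K f) = 2 * e * ip (K f) (K g).
Proof.
move=> Lf; move: f Lf g; apply: L2_ind => [f Lf f0|f f' Lf Lf' Hf Hf' g Lg]; last first.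
  have LKf := resolvent_L2 Lf; have LKf' := resolvent_L2 Lf'; have LKg := resolvent_L2 Lg.
  rewrite resolventB// (ipBl Lf Lf' LKg) (ipBr LKf LKf' Lg) (ipBl LKf LKf' LKg) mulrBr.
  by rewrite -(Hf _ Lg) -(Hf' _ Lg); ring.
apply: L2_ind => [g Lg g0|g g' Lg Lg' Hg Hg']; last first.
  have LKf := resolvent_L2 Lf; have LKg := resolvent_L2 Lg; have LKg' := resolvent_L2 Lg'.
  rewrite resolventB// (ipBl Lg Lg' LKf) (ipBr LKg LKg' Lf) (ipBr LKg LKg' LKf) mulrBr.
  by rewrite -Hg -Hg'; ring.
have LKf := resolvent_L2 Lf; have LKg := resolvent_L2 Lg.
have := ge0_resolvent_adjoint Lf Lg f0 g0.
by rewrite -!EFin_ip// -EFinD -EFinM => -[].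
Qed.

End Resolvent.

(** * Primitives and the equation psi' - e psi = phi *)

Section Primitive.
Context {R : realType}.
Local Notation mu := (@lebesgue_measure R).
Implicit Types q : R -> R.

Definition primitive q (y : R) : R := \int[mu]_(x in `]-oo, y]) q x.

Variable q : R -> R.
Hypotheses (cq : continuous q) (M : R) (q0 : forall x, M < `|x| -> q x = 0).

Lemma is_derive_primitive y : is_derive y (1 : R) (primitive q) (q y).
Proof.
have intq : mu.-integrable `]-oo, (y + 1)] (EFin \o q).
  apply: (@integrableS _ _ _ mu setT) => //.
  by apply: continuous_bounded_support_integrable => //; exists M.
have yu : y < y + 1 by rewrite ltrDl.
have yo : (-oo%O < BRight y)%E by rewrite ltNyr.
have [] := continuous_FTC1 yu intq yo (@cq y).
by move=> d <-; rewrite derive1E; exact: derivableP.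
Qed.

Lemma primitive_left y : y < - M -> primitive q y = 0.
Proof.
move=> yM; rewrite /primitive /Rintegral integral0_eq// => x /=.
rewrite in_itv/= => xy; rewrite q0//.
by have := ler_norm (- x); rewrite normrN; lra.
Qed.

Lemma primitive_right y : M < y -> primitive q y = \int[mu]_x q x.
Proof.
move=> My; rewrite /primitive Rintegral_mkcond; apply: eq_Rintegral => x _.
rewrite patchE mem_setE in_itv/=; case: ifPn => //; rewrite -ltNge => yx.
by rewrite q0// (lt_le_trans (lt_trans My yx))// ler_norm.
Qed.

End Primitive.

Section TestPrimitive.
Context {R : realType}.
Local Notation mu := (@lebesgue_measure R).
Variable e : R.
Hypothesis e0 : 0 < e.

(** The solution psi0 of psi0' - e psi0 = phi that vanishes near -oo equals
    C exp(e x) near +oo. Subtracting exp(- e T) psi0 (x + T) cancels this tail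
    and makes psi compactly supported; the price is the translate of phi in the
    right hand side, which is small for large T. *)
Lemma test_solution phi T : test_function phi -> 0 <= T ->
  exists psi, test_function psi /\
    forall x, derive1 psi x - e * psi x = phi x - expR (- (e * T)) * phi (x + T).
Proof.
move=> tphi T0; have [dphi [M phi0]] := (testP phi).1 tphi.
have cphi := test_continuous tphi.
have dexp c (x : R) : is_derive x (1 : R) (fun x => expR (c * x)) (c * expR (c * x)).
  have dl : is_derive x (1 : R) (fun x : R => c * x) c.
    by apply: is_derive_eq; rewrite [_ *: _]mulr1.
  by apply: is_derive_eq; rewrite mulrC.
pose q x := expR (- e * x) * phi x.
have cq : continuous q.
  move=> x; apply: cvgM; last exact: cphi.
  have : {for x, continuous (fun x : R => expR (- e * x))}.
    by apply/differentiable_continuous/derivable1_diffP; case: (dexp (- e) x).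
  exact.
have q0 x : M < `|x| -> q x = 0 by move=> Mx; rewrite /q phi0// mulr0.
pose psi0 y := expR (e * y) * primitive q y.
have dpsi0 y : is_derive y (1 : R) psi0 (e * psi0 y + phi y).
  have := is_deriveM (dexp e y) (is_derive_primitive cq q0 y) => dM.
  apply: is_derive_eq.
  have ee : expR (e * y) * expR (- e * y) = 1 by rewrite -expRD mulNr subrr expR0.
  rewrite /GRing.scale/= /psi0 /q (mulrA (expR (e * y)) _ (phi y)) ee; ring.
have npsi0 n : diff_order n psi0.
  elim: n => [y|n IH]; first by case: (dpsi0 y).
  exists (fun y => e * psi0 y + phi y); split => //.
  by apply: diff_orderD => //; apply: diff_orderM => //; exact: diff_order_cst.
pose psi y := psi0 y - expR (- (e * T)) * psi0 (1 * y + T).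
have dT (y : R) : is_derive y (1 : R) (fun y => 1 * y + T) 1.
  by apply: is_derive_eq; rewrite addr0 [_ *: _]mulr1.
exists psi; split; last first.
  move=> x; rewrite derive1E.
  have d1 := @is_derive1_comp _ psi0 (fun y => 1 * y + T) _ _ _ (dpsi0 _) (dT x).
  have d2 := is_deriveB (dpsi0 x) (is_deriveZ (expR (- (e * T))) d1).
  have -> : 'D_1 psi x = (e * psi0 x + phi x) -
     expR (- (e * T)) * (e * psi0 (1 * x + T) + phi (1 * x + T)).
    rewrite (@derive_val _ _ _ _ _ _ _ d2) /GRing.scale/=; ring.
  rewrite /psi mul1r; ring.
apply/testP; split.
  move=> n; apply: diff_orderD => //.
  have -> : (fun x => - (expR (- (e * T)) * psi0 (1 * x + T))) =
            (fun x => (- expR (- (e * T))) * psi0 (1 * x + T)).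
    by apply/funext => x; rewrite mulNr.
  by apply: diff_orderM; [exact: diff_order_cst|exact: diff_order_affine].
exists (`|M| + T) => x xMT; rewrite /psi /psi0 mul1r.
have M' := ler_norm M.
have [x0|x0] := leP 0 x.
  rewrite (ger0_norm x0) in xMT.
  have Mx : M < x by lra.
  have MxT : M < x + T by rewrite (lt_le_trans Mx)// lerDl.
  rewrite !(primitive_right q0)// mulrA -expRD mulrDr addrCA addNr addr0.
  by rewrite subrr.
rewrite (ltr0_norm x0) in xMT.
have xM : x < - M by lra.
have xTM : x + T < - M by rewrite -ltrBrDr; lra.
by rewrite !(primitive_left q0)// !mulr0 subrr.
Qed.

Lemma ip_shift phi T : test_function phi ->
  ip (fun x : R => phi (x + T)) (fun x : R => phi (x + T)) = ip phi phi.
Proof.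
move=> tphi; have cphi := test_continuous tphi.
have dT (x : R) : is_derive x (1 : R) (fun x => x + T) 1.
  by apply: is_derive_eq; rewrite addr0.
have dTE : derive1 (fun x => x + T) = cst (1 : R).
  by apply/funext => x; rewrite derive1E; exact: derive_val.
rewrite ip.unlock /Rintegral; congr fine; apply/esym.
rewrite (@increasing_ge0_integration_by_substitutionT R (fun x => x + T)
   (fun x => phi x * phi x)).
- by apply: eq_integral => x _ /=; rewrite dTE mulr1.
- by move=> x y xy; rewrite ltrD2r.
- by rewrite dTE => x; exact: cvg_cst.
- by rewrite dTE; exact: is_cvg_cst.
- by rewrite dTE; exact: is_cvg_cst.
- by move=> x; case: (dT x).
- exact: cvg_addrr_Ny.
- exact: cvg_addrr.
- by move=> x; apply: cvgM; exact: cphi.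
- by move=> x; rewrite -expr2 sqr_ge0.
Qed.

End TestPrimitive.

(** * The resolvent of a weak derivative *)

Section ResolventDerivative.
Context {R : realType}.
Local Notation mu := (@lebesgue_measure R).
Variable e : R.
Hypothesis e0 : 0 < e.
Implicit Types f g h phi psi : R -> R.
Local Notation K := (resolvent e).

Lemma ip_resolvent f : L2 f -> ip f (K f) = e * ip (K f) (K f).
Proof. by move=> Lf; have := resolvent_adjoint e0 Lf Lf; lra. Qed.

Lemma ip_sub_resolvent f : L2 f ->
  ip (fun x => f x - e * K f x) (fun x => f x - e * K f x) =
  ip f f - e ^+ 2 * ip (K f) (K f).
Proof.
move=> Lf; have LK := resolvent_L2 e0 Lf; have LeK := L2Z e LK.
rewrite (ipBl Lf LeK (L2B Lf LeK)) (ipBr Lf LeK Lf) (ipBr Lf LeK LeK).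
rewrite (ipZl e LK Lf) (ipZr e LK Lf) (ipZr e LK LeK) (ipZl e LK LK).
rewrite (ipC (K f) f) ip_resolvent//; ring.
Qed.

Lemma resolvent_contraction f : L2 f -> e ^+ 2 * ip (K f) (K f) <= ip f f.
Proof.
by move=> Lf; rewrite -subr_ge0 -ip_sub_resolvent// ip_ge0.
Qed.

(** K inverts d/dx + e on test functions, by the fundamental theorem of calculus
    for exp(e (x - z)) psi x on [a, z] with a to the left of the support. *)
Lemma resolvent_test psi : test_function psi -> K (fun x => derive1 psi x + e * psi x) = psi.
Proof.
move=> tpsi; apply/funext => z.
have tpsi' := test_derive1 tpsi.
have [_ [M psi0]] := (testP psi).1 tpsi.
have [_ [N psi0']] := (testP (derive1 psi)).1 tpsi'.
pose a := - (`|M| + `|N| + `|z| + 1).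
have az : a < z.
  have := normr_ge0 M; have := normr_ge0 N; have := ler_norm (- z).
  rewrite normrN /a; lra.
have out x : x <= a -> psi x = 0 /\ derive1 psi x = 0.
  move=> xa; have h1 := normr_ge0 M; have h2 := normr_ge0 N; have h3 := ler_norm (- x).
  have h4 := ler_norm M; have h5 := ler_norm N; have h6 := normr_ge0 z.
  rewrite normrN in h3; rewrite /a in xa.
  by split; [apply: psi0|apply: psi0']; lra.
pose F x := expR (e * (x - z)) * psi x.
pose f x := expR (e * (x - z)) * (derive1 psi x + e * psi x).
have dF (x : R) : is_derive x (1 : R) F (f x).
  have dl : is_derive x (1 : R) (fun x : R => e * (x - z)) e.
    by apply: is_derive_eq; rewrite subr0 [_ *: _]mulr1.
  have dE := is_derive1_comp (is_derive_expR _) dl.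
  have dM := is_deriveM dE (test_is_derive x tpsi).
  by apply: is_derive_eq; rewrite /GRing.scale/= /f; ring.
have cE : continuous (fun x : R => expR (e * (x - z))).
  move=> x; apply: continuous_comp; last exact: continuous_expR.
  by apply: cvgMr; apply: cvgB => //; exact: cvg_cst.
have cF : continuous F.
  by move=> x; apply/differentiable_continuous/derivable1_diffP; case: (dF x).
have cf : continuous f.
  move=> x; apply: cvgM; first exact: cE.
  by apply: cvgD; [exact: test_continuous|apply: cvgMr; exact: test_continuous].
have := @continuous_FTC2 R f F a z az (continuous_subspaceT cf) _ _.
have -> : F a = 0 by rewrite /F (out a (lexx _)).1 mulr0.
have -> : F z = psi z by rewrite /F subrr mulr0 expR0 mul1r.
rewrite sube0 => FTC; apply: EFin_inj; rewrite -FTC.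
- rewrite resolventE//; last by apply: L2D; [exact: test_L2|apply: L2Z; exact: test_L2].
  rewrite [RHS]integral_mkcond; apply: eq_integral => x _.
  rewrite patchE mem_setE in_itv/= /exp_ker /f.
  have [ax|/ltW xa] := leP a x; last first.
    by have [-> ->] := out x xa; rewrite mulr0 addr0 mulr0.
  case: leP => xz /=; last by rewrite mul0r.
  by rewrite -mulrN opprB.
- split.
  + by move=> x _; case: (dF x).
  + by apply: cvg_at_right_filter; exact: cF.
  + by apply: cvg_at_left_filter; exact: cF.
- by move=> x _; rewrite derive1E; apply: derive_val.
Qed.

(** First order weak derivatives in terms of the inner product alone. *)
Definition weak_deriv f f' :=
  forall phi, test_function phi -> ip f (derive1 phi) = - ip f' phi.

(** Weak solutions of h' + e h = 0 are multiples of exp(- e x), which are not in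
    L^2 unless they vanish. In terms of test functions: by test_solution,
    <h, phi> = exp(- e T) <h, phi(. + T)> for all T >= 0, and the right hand
    side tends to 0 as T grows. *)
Lemma weak_solution0 h : L2 h ->
  (forall psi, test_function psi ->
    ip h (fun x => derive1 psi x - e * psi x) = 0) ->
  {ae mu, forall x, h x = 0}.
Proof.
move=> Lh h0; apply: du_Bois_Reymond => // phi tphi.
have Lphi := test_L2 tphi.
have LT T : L2 (fun x => phi (x + T)).
  have tT : test_function (fun x => phi (1 * x + T)).
    have [dphi [M phi0]] := (testP phi).1 tphi.
    apply/testP; split; first by move=> n; exact: diff_order_affine.
    exists (M + `|T|) => x xM; apply: phi0; rewrite mul1r.
    by have := lerB_normD x T; lra.
  by have := test_L2 tT; congr L2; apply/funext => x; rewrite mul1r.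
have nT T : L2norm (fun x => phi (x + T)) = L2norm phi.
  by apply/eqP; rewrite -(@eqrXn2 _ 2) ?L2norm_ge0// !sqr_L2norm ip_shift.
have bound T : 0 <= T -> `|ip h phi| * expR (e * T) <= L2norm h * L2norm phi.
  move=> T0; have [psi [tpsi psiE]] := test_solution e tphi T0.
  have := h0 psi tpsi; rewrite (funext psiE).
  rewrite (ipBr Lphi (L2Z _ (LT T)) Lh) ipZr// => /subr0_eq ->.
  rewrite normrM ger0_norm ?expR_ge0// mulrAC -expRD addNr expR0 mul1r.
  by have := L2_CauchySchwarz Lh (LT T); rewrite nT.
apply/eqP; rewrite -normr_eq0 eq_le normr_ge0 andbT leNgt; apply/negP => A0.
set A := `|ip h phi| in A0 bound; set C := L2norm h * L2norm phi in bound.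
have C0 : 0 <= C by rewrite mulr_ge0// L2norm_ge0.
have T0 : 0 <= C / (e * A) by rewrite divr_ge0// mulr_ge0// ltW.
have := bound _ T0.
(* This T contradicts the bound because A * exp(e T) >= A (1 + e T) = A + C. *)
have : A * (1 + e * (C / (e * A))) <= A * expR (e * (C / (e * A))).
  by rewrite ler_wpM2l ?(ltW A0)// expR_ge1Dx.
have -> : A * (1 + e * (C / (e * A))) = A + C.
  by field; rewrite ?(gt_eqF A0) ?(gt_eqF e0).
lra.
Qed.

(** The difference of both sides solves h' + e h = 0 weakly. To test K f' and
    K f against psi' - e psi, apply the adjoint identity to g = psi' + e psi,
    for which K g = psi: this turns <K f, psi' - e psi> into - <f, psi>. *)
Lemma resolvent_weak_deriv f f' : L2 f -> L2 f' -> weak_deriv f f' ->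
  {ae mu, forall x, K f' x = f x - e * K f x}.
Proof.
move=> Lf Lf' wf.
have LKf := resolvent_L2 e0 Lf; have LKf' := resolvent_L2 e0 Lf'; have LeK := L2Z e LKf.
have Lr := L2B Lf LeK.
have : {ae mu, forall x, K f' x - (f x - e * K f x) = 0}.
  apply: weak_solution0 => [|psi tpsi]; first exact: L2B.
  have Lpsi := test_L2 tpsi; have Lpsi' := test_L2 (test_derive1 tpsi).
  have Lepsi := L2Z e Lpsi; have Lg := L2D Lpsi' Lepsi.
  have := resolvent_adjoint e0 Lf' Lg; have := resolvent_adjoint e0 Lf Lg.
  rewrite resolvent_test// !(ipDl Lpsi' Lepsi)// !(ipZl e Lpsi)//.
  rewrite (ipBl LKf' Lr (L2B Lpsi' Lepsi)) (ipBl Lf LeK (L2B Lpsi' Lepsi)).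
  rewrite (ipZl e LKf (L2B Lpsi' Lepsi)) !(ipBr Lpsi' Lepsi)// !(ipZr e Lpsi)//.
  rewrite (wf _ tpsi) (ipC psi) (ipC psi) (ipC (derive1 psi)) (ipC (derive1 psi)).
  move=> h1 h2.
  have {}h1 : ip (K f) (derive1 psi) = e * ip (K f) psi - ip f psi by lra.
  have {}h2 : ip (K f') (derive1 psi) = e * ip (K f') psi - ip f' psi by lra.
  rewrite h1 h2; ring.
apply: filterS; first exact: (ae_filter_ringOfSetsType mu).
by move=> x /= /subr0_eq.
Qed.

End ResolventDerivative.

(** * Weak derivatives and Sobolev norms *)

Section Sobolev.
Context {R : realType}.
Local Notation mu := (@lebesgue_measure R).
Implicit Types f g h phi psi : R -> R.

Lemma integral_derive1_test psi : test_function psi ->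
  \int[mu]_x derive1 psi x = 0.
Proof.
move=> tpsi; have tpsi' := test_derive1 tpsi.
have [_ [M psi0]] := (testP psi).1 tpsi.
have [_ [N psi0']] := (testP (derive1 psi)).1 tpsi'.
pose B := `|M| + `|N| + 1.
have hM := ler_norm M; have hN := ler_norm N.
have hM0 := normr_ge0 M; have hN0 := normr_ge0 N.
have qB x : B < `|x| -> derive1 psi x = 0 by move=> xB; apply: psi0'; rewrite /B in xB; lra.
have pB x : B < `|x| -> psi x = 0 by move=> xB; apply: psi0; rewrite /B in xB; lra.
have cq := test_continuous tpsi'.
have B0 : 0 < B by rewrite /B; lra.
rewrite -(primitive_right qB (_ : B < B + 1)) ?ltrDl//.
pose d x := primitive (derive1 psi) x - psi x.
have dd x : is_derive x (1 : R) d 0.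
  have := is_deriveB (is_derive_primitive cq qB x) (test_is_derive x tpsi).
  by rewrite subrr.
have := is_derive_0_is_cst (B + 1) (- (B + 1)) dd; rewrite /d.
have BB : - (B + 1) < - B by rewrite ltrN2 ltrDl.
rewrite (primitive_left qB BB) !pB ?subr0//.
- by rewrite normrN ger0_norm; lra.
- by rewrite ger0_norm; lra.
Qed.

Lemma weak_deriv_smooth f f' : (forall n, diff_order n f) ->
  (forall x : R, is_derive x 1 f (f' x)) -> L2 f -> L2 f' -> weak_deriv f f'.
Proof.
move=> nf df Lf Lf' phi tphi; have tphi' := test_derive1 tphi.
have [nphi [M phi0]] := (testP phi).1 tphi.
have tfphi : test_function (fun x => f x * phi x).
  apply/testP; split; first by move=> n; exact: diff_orderM.
  by exists M => x Mx; rewrite phi0// mulr0.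
have Lphi := test_L2 tphi; have Lphi' := test_L2 tphi'.
apply/eqP; rewrite -addr_eq0 ip.unlock -RintegralD//; [|exact: L2M_integrable..].
rewrite -[X in _ == X](integral_derive1_test tfphi); apply/eqP.
apply: eq_Rintegral => x _; rewrite [RHS]derive1E.
have [_ dE] := is_deriveM (df x) (test_is_derive x tphi).
by apply: (etrans _ (esym dE)); rewrite /GRing.scale/= (mulrC (phi x)).
Qed.

Lemma weak_deriv_primitive (q : R -> R) : test_function q -> L2 (primitive q) ->
  weak_deriv (primitive q) q.
Proof.
move=> tq Lp; have [nq [M q0]] := (testP q).1 tq.
have dp := is_derive_primitive (test_continuous tq) q0.
apply: weak_deriv_smooth => //; last exact: test_L2.
by case=> [x|n]; [case: (dp x)|exists q].
Qed.

Lemma weakDP j f : (exists g, L2 g /\ is_weak_derivative j f g) ->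
  L2 (weakD j f) /\ is_weak_derivative j f (weakD j f).
Proof.
by move=> [g Hg]; apply: (@xgetPex _ (cst 0) [set g | L2 g /\ is_weak_derivative j f g]); exists g.
Qed.

Lemma eq_L2norm f g : L2 f -> L2 g -> {ae mu, forall x, f x = g x} ->
  L2norm f = L2norm g.
Proof.
move=> Lf Lg fg; apply/eqP; rewrite -(@eqrXn2 _ 2) ?L2norm_ge0// !sqr_L2norm.
by rewrite (eq_ip Lf Lg Lf Lg).
Qed.

(** The chosen representative of the weak derivative of order 0 is f up to a null
    set, by du_Bois_Reymond. *)
Lemma Hnorm0 f : L2 f -> Hnorm 0 f = L2norm f.
Proof.
move=> Lf; have lf := L2_locally_integrable Lf.
have [Lg [_ _ fg]] : L2 (weakD 0 f) /\ is_weak_derivative 0 f (weakD 0 f).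
  apply: weakDP; exists f; split => //; split => // phi _.
  by rewrite expr0 mul1r.
rewrite /Hnorm big_ord1 sqrtr_sqr ger0_norm ?L2norm_ge0//.
apply: eq_L2norm => //.
have : {ae mu, forall x, weakD 0 f x - f x = 0}.
  apply: du_Bois_Reymond => [|phi tphi]; first exact: L2B.
  have := fg phi tphi; rewrite expr0 mul1r.
  by rewrite (ipBl Lg Lf (test_L2 tphi)) ip.unlock => ->; rewrite subrr.
apply: filterS; first exact: (ae_filter_ringOfSetsType mu).
by move=> x /= /subr0_eq.
Qed.

Lemma Hk2_weak_deriv f : Hk 2 f -> exists g, [/\ L2 g, L2 (weakD 2 f),
  weak_deriv f g & weak_deriv g (weakD 2 f)].
Proof.
move=> [Lf Hf].
have [L1 [_ _ w1]] := weakDP (Hf 1%N isT).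
have [L2' [_ _ w2]] := weakDP (Hf 2%N isT).
have wd1 : weak_deriv f (weakD 1 f).
  by move=> phi tphi; have := w1 phi tphi; rewrite expr1 mulN1r ip.unlock.
exists (weakD 1 f); split => // phi tphi.
have := wd1 _ (test_derive1 tphi); have := w2 phi tphi.
by rewrite sqrrN expr1n mul1r ip.unlock => -> ->; rewrite opprK.
Qed.

Variable e : R.
Hypothesis e0 : 0 < e.
Local Notation K := (resolvent e).

(** Formally K f'' = K (d/dx)^2 f = f' - e f + e^2 K f, and <f' - e f, K w> is
    - <f, w>: moving the derivative to K w turns it into - <f, (d/dx + e) K w>. *)
Lemma ip_resolvent_weak_deriv2 f f' f'' w : L2 f -> L2 f' -> L2 f'' -> L2 w ->
  weak_deriv f f' -> weak_deriv f' f'' ->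
  ip (K f'') (K w) = e ^+ 2 * ip (K f) (K w) - ip w f.
Proof.
move=> Lf Lf' Lf'' Lw ff' f'f''.
have LK := @resolvent_L2 _ _ e0; have LKw := LK _ Lw.
have LeKf := L2Z e (LK _ Lf); have LeKf' := L2Z e (LK _ Lf').
have K1 g : L2 g -> ip (K f') g = ip f g - e * ip (K f) g.
  move=> Lg; rewrite -(ipZl e (LK _ Lf) Lg) -(ipBl Lf LeKf Lg).
  by apply: eq_ip => //; [exact: LK|exact: L2B|exact: resolvent_weak_deriv|exact: aeW].
have K2 : ip (K f'') (K w) = ip f' (K w) - e * ip (K f') (K w).
  rewrite -(ipZl e (LK _ Lf') LKw) -(ipBl Lf' LeKf' LKw).
  by apply: eq_ip => //; [exact: LK|exact: L2B|exact: resolvent_weak_deriv|exact: aeW].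
have := resolvent_adjoint e0 Lf' Lw; have := resolvent_adjoint e0 Lf Lw.
rewrite K2 (ipC w (K f')) !K1// (ipC w (K f)) (ipC w f).
nra.
Qed.

End Sobolev.

(** * Derivatives on the closed half-line *)

Section HalfLineDerivative.
Context {R : realType}.
Implicit Types f g : R -> R.

Global Instance nbhs_half_filter (t : R) : Filter (nbhs_half t).
Proof. by rewrite /nbhs_half; apply: within_filter. Qed.

Lemma nbhs_half_near (t : R) (P : R -> Prop) :
  (forall s, 0 <= s -> s != t -> P s) -> \forall s \near nbhs_half t, P s.
Proof.
move=> HP; rewrite /nbhs_half near_withinE; near=> s => /=.
rewrite in_itv/= andbT => s0; apply: HP => //.
by near: s; exact: nbhs_dnbhs_neq.
Unshelve. all: by end_near. Qed.

Lemma nbhs_half_id (t : R) : s @[s --> nbhs_half t] --> t.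
Proof.
move=> A At; rewrite /nbhs_half /=; apply: cvg_within.
exact: (@cvg_within _ _ _ _).
Qed.

Definition half_deriv f (t l : R) :=
  (f s - f t) / (s - t) @[s --> nbhs_half t] --> l.

Lemma half_deriv_cvg f t l : half_deriv f t l -> f s @[s --> nbhs_half t] --> f t.
Proof.
move=> dft; rewrite -[X in _ --> X]add0r -[X in _ --> X + _](mulr0 l).
have : (f s - f t) / (s - t) * (s - t) + f t @[s --> nbhs_half t] --> l * 0 + f t.
  apply: cvgD; last exact: cvg_cst.
  apply: cvgM => //; rewrite -(subrr t); apply: cvgB; last exact: cvg_cst.
  exact: nbhs_half_id.
apply: cvg_trans; apply: near_eq_cvg; apply: nbhs_half_near => s _ st.
by rewrite divfK ?subr_eq0// subrK.
Qed.

Lemma half_derivD f g t l m : half_deriv f t l -> half_deriv g t m ->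
  half_deriv (fun s => f s + g s) t (l + m).
Proof.
move=> df dg; rewrite /half_deriv.
under eq_fun do rewrite opprD addrACA mulrDl.
exact: cvgD.
Qed.

Lemma half_derivM f g t l m : half_deriv f t l -> half_deriv g t m ->
  half_deriv (fun s => f s * g s) t (l * g t + f t * m).
Proof.
move=> df dg; rewrite /half_deriv.
have -> : (fun s => (f s * g s - f t * g t) / (s - t)) =
   (fun s => (f s - f t) / (s - t) * g s + f t * ((g s - g t) / (s - t))).
  by apply/funext => s; ring.
apply: cvgD; first by apply: cvgM => //; exact: half_deriv_cvg dg.
exact: cvgMr.
Qed.

Lemma half_deriv_is_derive f t l : 0 < t -> half_deriv f t l ->
  is_derive t (1 : R) f l.
Proof.
move=> t0 /cvgrPdist_le dft.
suff dl : h^-1 *: (f (h *: (1 : R) + t) - f t) @[h --> 0^'] --> l.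
  by apply: DeriveDef; [apply/cvg_ex; exists l|exact/cvg_lim].
apply/cvgrPdist_le => eps eps0.
have near_t : \forall s \near t, s != t -> s \in `[0, +oo[ ->
    `|l - (f s - f t) / (s - t)| <= eps := dft eps eps0.
have nt_near : \forall h \near (0 : R), - t <= h.
  by have := lt_nbhsr (_ : - t < 0); rewrite oppr_lt0 => /(_ t0); apply: filterS => h /ltW.
have {near_t}/nbhs0P near_0 := near_t.
rewrite /dnbhs near_withinE; near=> h => /= h0.
have := near near_0 h; rewrite addrC.
rewrite -subr_eq0 addrK in_itv/= andbT [h *: 1]mulr1.
rewrite [_ *: _]mulrC; apply => //.
have : - t <= h by near: h; exact: nt_near.
by lra.
Unshelve. all: by end_near. Qed.

Lemma half_deriv_continuous f df (T : R) : 0 < T ->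
  (forall t, 0 <= t -> half_deriv f t (df t)) ->
  {within `[0, T], continuous f}.
Proof.
move=> T0 dft.
have cf t : 0 < t -> {for t, continuous f}.
  move=> t0; apply/differentiable_continuous/derivable1_diffP.
  by case: (half_deriv_is_derive t0 (dft _ (ltW t0))).
apply/(continuous_within_itvP _ T0); split.
- by move=> t; rewrite in_itv/= => /andP[t0 _]; exact: cf.
- have := half_deriv_cvg (dft 0 (lexx 0)).
  apply: cvg_trans => A; rewrite /nbhs_half => A0.
  have {}A0 : \forall s \near (0 : R), s != 0 -> s \in `[0, +oo[ -> A (f s) := A0.
  suff : \forall s \near (0 : R), 0 < s -> A (f s) by [].
  apply: filterS A0 => s As s0.
  by apply: As; rewrite ?gt_eqF// in_itv/= andbT ltW.
- by apply: cvg_at_left_filter; exact: cf.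
Qed.

End HalfLineDerivative.

Section L2Derivative.
Context {R : realType}.
Local Notation mu := (@lebesgue_measure R).
Implicit Types (f g : R -> R) (U : R -> R -> R).

Definition L2_half_deriv U (t : R) dU :=
  L2norm (fun x => (U s x - U t x) / (s - t) - dU x) @[s --> nbhs_half t] --> (0 : R).

Lemma L2_diff_quotient U s t : L2 (U s) -> L2 (U t) ->
  L2 (fun x => (U s x - U t x) / (s - t)).
Proof.
move=> Ls Lt; have := L2Z (s - t)^-1 (L2B Ls Lt).
by congr L2; apply/funext => x; rewrite mulrC.
Qed.

Lemma is_derive_H0P U dU t : 0 <= t -> is_derive_H 0 U dU ->
  L2 (U t) /\ L2 (dU t) /\ L2_half_deriv U t (dU t).
Proof.
move=> t0 HU; have [[Lt _] [Ldt _] dUt] := HU t t0; split => //; split => //.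
apply: cvg_trans dUt; apply: near_eq_cvg; apply: nbhs_half_near => s s0 _.
have [[Ls _] _ _] := HU s s0.
by rewrite Hnorm0//; apply: L2B => //; exact: L2_diff_quotient.
Qed.

(** Write U s = U t + (s - t) (D s + dU), where D s tends to 0 in L^2, and expand
    the inner product. *)
Lemma L2_half_deriv_ip U dU t : (forall s, 0 <= s -> L2 (U s)) -> 0 <= t -> L2 dU ->
  L2_half_deriv U t dU ->
  half_deriv (fun s => ip (U s) (U s)) t (2 * ip dU (U t)).
Proof.
move=> LU t0 LdU dUt; have Lt := LU t t0.
pose D s := (fun x => (U s x - U t x) / (s - t) - dU x).
have LD s : 0 <= s -> L2 (D s).
  by move=> s0; apply: L2B => //; apply: L2_diff_quotient => //; exact: LU.
have ipD0 h : L2 h -> ip (D s) h @[s --> nbhs_half t] --> (0 : R).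
  move=> Lh; apply/norm_cvg0P.
  apply: (@squeeze_cvgr _ _ _ _ (cst 0) (fun s => L2norm (D s) * L2norm h)).
  - apply: nbhs_half_near => s s0 _ /=; rewrite normr_ge0/=.
    by apply: L2_CauchySchwarz => //; exact: LD.
  - exact: cvg_cst.
  - by rewrite -(mul0r (L2norm h)); apply: cvgMl.
have ipDD : ip (D s) (D s) @[s --> nbhs_half t] --> (0 : R).
  under eq_fun do rewrite -sqr_L2norm expr2.
  by rewrite -(mulr0 0); apply: cvgM.
have expand : {near nbhs_half t,
    (fun s => 2 * ip (D s) (U t) + 2 * ip dU (U t) +
      (s - t) * (ip (D s) (D s) + 2 * ip (D s) dU + ip dU dU)) =1
    (fun s => (ip (U s) (U s) - ip (U t) (U t)) / (s - t))}.
  apply: nbhs_half_near => s s0 st.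
  have st0 : s - t != 0 by rewrite subr_eq0.
  have LQ := L2D (LD _ s0) LdU; have LsQ := L2Z (s - t) LQ.
  have -> : U s = (fun x => U t x + (s - t) * (D s x + dU x)).
    by apply/funext => x; rewrite /D subrK mulrC divfK// addrC subrK.
  rewrite (ipDl Lt LsQ (L2D Lt LsQ)) (ipDr Lt LsQ Lt) (ipDr Lt LsQ LsQ).
  rewrite (ipZr _ LQ Lt) (ipZl _ LQ Lt) (ipZr _ LQ LsQ) (ipZl _ LQ LQ).
  rewrite (ipDr (LD _ s0) LdU Lt) (ipDl (LD _ s0) LdU Lt).
  rewrite (ipDl (LD _ s0) LdU LQ) (ipDr (LD _ s0) LdU (LD _ s0)) (ipDr (LD _ s0) LdU LdU).
  rewrite (ipC (U t) (D s)) (ipC (U t) dU) (ipC dU (D s)).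
  by field.
have lim : 2 * ip (D s) (U t) + 2 * ip dU (U t) +
    (s - t) * (ip (D s) (D s) + 2 * ip (D s) dU + ip dU dU) @[s --> nbhs_half t]
    --> 2 * 0 + 2 * ip dU (U t) + 0 * (0 + 2 * 0 + ip dU dU).
  apply: cvgD.
    by apply: cvgD; [apply: cvgMr; exact: ipD0|exact: cvg_cst].
  apply: cvgM.
    by rewrite -(subrr t); apply: cvgB; [exact: nbhs_half_id|exact: cvg_cst].
  apply: cvgD; last exact: cvg_cst.
  by apply: cvgD => //; apply: cvgMr; exact: ipD0.
rewrite mulr0 add0r mul0r addr0 in lim.
exact: cvg_trans (near_eq_cvg expand) lim.
Qed.

Variable e : R.
Hypothesis e0 : 0 < e.
Local Notation K := (resolvent e).

Lemma L2norm_resolvent f : L2 f -> L2norm (K f) <= e^-1 * L2norm f.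
Proof.
move=> Lf; rewrite ler_pdivlMl//.
rewrite -(@ler_pXn2r _ 2) ?nnegrE ?L2norm_ge0 ?mulr_ge0 ?L2norm_ge0 ?(ltW e0)//.
by rewrite exprMn !sqr_L2norm resolvent_contraction.
Qed.

Lemma L2_half_deriv_resolvent U dU t : (forall s, 0 <= s -> L2 (U s)) -> 0 <= t -> L2 dU ->
  L2_half_deriv U t dU -> L2_half_deriv (fun s => K (U s)) t (K dU).
Proof.
move=> LU t0 LdU dUt; have Lt := LU t t0.
apply: (@squeeze_cvgr _ _ _ _ (cst 0) (fun s => e^-1 *
   L2norm (fun x => (U s x - U t x) / (s - t) - dU x))).
- apply: nbhs_half_near => s s0 _ /=; rewrite L2norm_ge0/=.
  have Ls := LU s s0; have LQ := L2_diff_quotient Ls Lt.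
  rewrite (le_trans _ (L2norm_resolvent (L2B LQ LdU)))// resolventB//.
  rewrite (_ : (fun x => (U s x - U t x) / (s - t)) =
     (fun x => (s - t)^-1 * (U s x - U t x))); last first.
    by apply/funext => x; rewrite mulrC.
  rewrite resolventZ//; last exact: L2B.
  rewrite resolventB// le_eqVlt; apply/orP; left; apply/eqP; congr L2norm.
  by apply/funext => x; rewrite (mulrC (s - t)^-1).
- exact: cvg_cst.
- by rewrite -(mulr0 e^-1); apply: cvgMr.
Qed.

End L2Derivative.

(** * Energy estimate *)

Lemma gronwall (R : realType) (E dE b : R -> R) (c d T : R) : 0 <= T ->
  (forall t, 0 <= t -> half_deriv E t (dE t)) ->
  {within `[0, +oo[, continuous b} ->
  (forall t, 0 < t -> dE t <= (c * b t + d) * E t) ->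
  E T <= E 0 * expR (c * \int[@lebesgue_measure R]_(s in `[0, T]) b s + d * T).
Proof.
move=> T0 hE cb dEb.
move: T0; rewrite le_eqVlt => /predU1P[<-|T0].
  by rewrite set_itv1 Rintegral_set1 !mulr0 addr0 expR0 mulr1.
have cbT : {within `[0, T], continuous b}.
  by apply: continuous_subspaceW cb; exact: subset_itvl.
have intb : (@lebesgue_measure R).-integrable `[0, T] (EFin \o b).
  by apply: continuous_compact_integrable => //; exact: segment_compact.
pose P t := \int[@lebesgue_measure R]_(s in `[0, t]) b s.
pose G t := E t * expR (- (c * P t + d * t)).
have dP t : 0 < t -> t < T -> is_derive t (1 : R) P (b t).
  move=> t0 tT.
  have bt : {for t, continuous b}.
    apply: (within_continuous_continuous T0 cbT).
    by rewrite in_itv/= t0 tT.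
  have [] := continuous_FTC1_closed tT intb t0 bt.
  by move=> dPt <-; rewrite derive1E; exact: derivableP.
have dG t : 0 < t -> t < T -> is_derive t (1 : R) G
    (expR (- (c * P t + d * t)) * (dE t - (c * b t + d) * E t)).
  move=> t0 tT.
  have dEt := half_deriv_is_derive t0 (hE t (ltW t0)).
  have dl : is_derive t (1 : R) (fun t => - (c * P t + d * t)) (- (c * b t + d)).
    have dd : is_derive t (1 : R) (fun t => d * t) d.
      by apply: is_derive_eq; rewrite [_ *: _]mulr1.
    exact: is_deriveN (is_deriveD (is_deriveZ c (dP t t0 tT)) dd).
  have dM := is_deriveM dEt (is_derive1_comp (is_derive_expR _) dl).
  by apply: is_derive_eq; rewrite /GRing.scale/=; ring.
have cP : {within `[0, T], continuous P}.
  exact: (parameterized_integral_continuous (ltW T0) intb).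
have cG : {within `[0, T], continuous G}.
  have cE := half_deriv_continuous T0 hE.
  move=> x; apply: cvgM; first exact: cE.
  apply: continuous_comp; last exact: continuous_expR.
  apply: cvgN; apply: cvgD; first by apply: cvgMr; exact: cP.
  by apply: cvgMr; apply: (continuous_subspaceT (fun=> cvg_id)).
have : G T <= G 0.
  apply: (ler0_derive1_le_cc _ _ cG).
  - by move=> t; rewrite in_itv/= => /andP[t0 tT]; case: (dG t t0 tT).
  - move=> t; rewrite in_itv/= => /andP[t0 tT].
    rewrite derive1E; have [_ ->] := dG t t0 tT.
    by rewrite pmulr_rle0 ?expR_gt0// subr_le0 dEb.
  - by rewrite in_itv/= lexx ltW.
  - by rewrite in_itv/= lexx ltW.
  - exact: ltW.
rewrite /G {2}/P set_itv1 Rintegral_set1 !mulr0 addr0 oppr0 expR0 mulr1.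
by rewrite expRN ler_pdivrMr ?expR_gt0.
Qed.

Section Energy.
Context {R : realType}.
Local Notation mu := (@lebesgue_measure R).
Variables (a da : R -> R) (u ut utt : R -> R -> R) (A0 M e : R).
Hypotheses (A0_gt0 : 0 < A0) (e0 : 0 < e).
Hypotheses (aA0 : forall t, 0 <= t -> A0 <= a t).
Hypotheses (aM : forall t, 0 <= t -> a t <= M).
Hypotheses (a_da : is_derive_half a da) (c_da : {within `[0, +oo[, continuous da}).
Hypotheses (u_ut : is_derive_H 0 u ut) (ut_utt : is_derive_H 0 ut utt).
Hypothesis u_H2 : forall t, 0 <= t -> Hk 2 (u t).
Hypothesis wave : forall t, 0 < t ->
  {ae mu, forall x, utt t x - a t ^+ 2 * weakD 2 (u t) x = 0}.
Local Notation K := (resolvent e).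

(** The energy of the regularized first order system, K u_t standing for the
    primitive of u_t. *)
Definition energy t := ip (K (ut t)) (K (ut t)) + a t ^+ 2 * ip (u t) (u t).

Let L2u t : 0 <= t -> L2 (u t).
Proof. by move=> t0; have [] := is_derive_H0P t0 u_ut. Qed.
Let L2ut t : 0 <= t -> L2 (ut t).
Proof. by move=> t0; have [_ []] := is_derive_H0P t0 u_ut. Qed.
Let L2utt t : 0 <= t -> L2 (utt t).
Proof. by move=> t0; have [_ []] := is_derive_H0P t0 ut_utt. Qed.

Definition energy_rate t :=
  2 * ip (K (utt t)) (K (ut t)) +
  ((da t * a t + a t * da t) * ip (u t) (u t) +
   a t * a t * (2 * ip (ut t) (u t))).

Lemma energy_half_deriv t : 0 <= t -> half_deriv energy t (energy_rate t).
Proof.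
move=> t0.
have [_ [_ du]] := is_derive_H0P t0 u_ut.
have [_ [_ dut]] := is_derive_H0P t0 ut_utt.
apply: half_derivD.
  apply: L2_half_deriv_ip => //.
  - by move=> s s0; apply: resolvent_L2 => //; exact: L2ut.
  - by apply: resolvent_L2 => //; exact: L2utt.
  - exact: (L2_half_deriv_resolvent e0 L2ut t0 (L2utt t0) dut).
apply: half_derivM; first exact: (half_derivM (a_da t0) (a_da t0)).
exact: (L2_half_deriv_ip L2u t0 (L2ut t0) du).
Qed.

Lemma energy_rate_le t : 0 < t ->
  energy_rate t <= (2 / A0 * `|da t| + e * M) * energy t.
Proof.
move=> /[dup] t0' /ltW t0.
have Lu := L2u t0; have Lw := L2ut t0; have Lutt := L2utt t0.
have [g [Lg Lg2 ug gg2]] := Hk2_weak_deriv (u_H2 t0).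
have LKu := resolvent_L2 e0 Lu; have LKw := resolvent_L2 e0 Lw; have LKg2 := resolvent_L2 e0 Lg2.
have a0 : 0 < a t by exact: lt_le_trans (aA0 t0).
have Kutt : ip (K (utt t)) (K (ut t)) =
    a t ^+ 2 * (e ^+ 2 * ip (K (u t)) (K (ut t)) - ip (ut t) (u t)).
  rewrite -(ip_resolvent_weak_deriv2 e0 Lu Lg Lg2 Lw ug gg2) -(ipZl _ LKg2 LKw) -resolventZ//.
  rewrite (eq_resolvent e0 Lutt (L2Z (a t ^+ 2) Lg2))//.
  have := wave t0'; apply: filterS; first exact: (ae_filter_ringOfSetsType mu).
  by move=> x /= /subr0_eq.
have KwKu : 2 * (e * a t) * ip (K (u t)) (K (ut t)) <=
    ip (K (ut t)) (K (ut t)) + (e * a t) ^+ 2 * ip (K (u t)) (K (u t)).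
  have LZ := L2Z (e * a t) LKu.
  have := ip_ge0 (fun x => K (ut t) x - (e * a t) * K (u t) x).
  rewrite (ipBl LKw LZ (L2B LKw LZ)) (ipBr LKw LZ LKw) (ipBr LKw LZ LZ).
  rewrite (ipZr _ LKu LKw) (ipZl _ LKu LKw) (ipZl _ LKu LZ) (ipZr _ LKu LKu).
  by rewrite (ipC (K (ut t)) (K (u t))); lra.
have Ku := resolvent_contraction e0 Lu.
rewrite /energy_rate Kutt /energy.
have := ip_ge0 (u t); have := ip_ge0 (K (ut t)).
move: (ip (u t) (u t)) (ip (K (ut t)) _) (ip (K (u t)) (K (u t))) Ku KwKu => U W Z Ku.
move: (ip (K (u t)) (K (ut t))) (ip (ut t) (u t)) => X Y KwKu W0 U0.
have ae0 : 0 <= e * a t by rewrite mulr_ge0// ltW.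
have E0 : 0 <= W + a t ^+ 2 * U by rewrite addr_ge0// mulr_ge0// sqr_ge0.
(* The error made by replacing the primitive of u_t by K u_t. *)
have smooth_err : 2 * (a t ^+ 2 * e ^+ 2) * X <= e * M * (W + a t ^+ 2 * U).
  have -> : 2 * (a t ^+ 2 * e ^+ 2) * X = e * a t * (2 * (e * a t) * X) by ring.
  apply: (@le_trans _ _ (e * a t * (W + a t ^+ 2 * U))); last first.
    by rewrite ler_wpM2r// ler_wpM2l ?(ltW e0)// aM.
  rewrite ler_wpM2l// (le_trans KwKu)// lerD2l.
  have -> : (e * a t) ^+ 2 * Z = a t ^+ 2 * (e ^+ 2 * Z) by ring.
  by rewrite ler_wpM2l// sqr_ge0.
(* The contribution of the variation of a, using a / A0 >= 1. *)
have coef_err : 2 * (da t * a t) * U <= 2 / A0 * `|da t| * (W + a t ^+ 2 * U).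
  apply: (@le_trans _ _ (2 / A0 * `|da t| * (a t ^+ 2 * U))); last first.
    by rewrite ler_wpM2l ?lerDr// mulr_ge0// divr_ge0// ltW.
  have -> : 2 / A0 * `|da t| * (a t ^+ 2 * U) = 2 * (`|da t| * (a t * (a t / A0))) * U.
    by field; rewrite gt_eqF.
  rewrite ler_wpM2r// ler_wpM2l//.
  apply: (@le_trans _ _ (`|da t| * a t)).
    by rewrite ler_wpM2r ?(ltW a0)// ler_norm.
  by rewrite ler_wpM2l// ler_peMr ?(ltW a0)// ler_pdivlMr// mul1r aA0.
lra.
Qed.

Lemma energy_le T : 0 <= T ->
  energy T <= energy 0 *
    expR (2 / A0 * \int[mu]_(s in `[0, T]) `|da s| + e * M * T).
Proof.
move=> T0; apply: gronwall => //.
- exact: energy_half_deriv.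
- by move=> x; apply: continuous_comp; [exact: c_da|exact: norm_continuous].
- exact: energy_rate_le.
Qed.

(** Since u1 is the derivative of v1 = primitive u1, the first term of the energy
    is ||v1 - e K v1||^2, which is at most ||v1||^2. *)
Lemma energy0_le (u0 u1 : R -> R) : test_function u0 -> test_function u1 ->
  L2 (primitive u1) ->
  {ae mu, forall x, u 0 x = u0 x} -> {ae mu, forall x, ut 0 x = u1 x} ->
  energy 0 <= L2norm (primitive u1) ^+ 2 + a 0 ^+ 2 * L2norm u0 ^+ 2.
Proof.
move=> tu0 tu1 Lv eu0 eu1.
have Lu0 := test_L2 tu0; have Lu1 := test_L2 tu1.
have Lu := L2u (lexx 0); have Lut := L2ut (lexx 0).
rewrite /energy (eq_ip Lu Lu0 Lu Lu0 eu0 eu0) !sqr_L2norm lerD2r.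
rewrite (eq_resolvent e0 Lut Lu1 eu1).
have LKv := resolvent_L2 e0 Lv; have LKu1 := resolvent_L2 e0 Lu1.
have Kv := resolvent_weak_deriv e0 Lv Lu1 (weak_deriv_primitive tu1 Lv).
have Lr := L2B Lv (L2Z e LKv).
rewrite (eq_ip LKu1 Lr LKu1 Lr Kv Kv) (ip_sub_resolvent e0 Lv) gerBl.
by rewrite mulr_ge0 ?sqr_ge0 ?ip_ge0.
Qed.

End Energy.

Lemma le_expR_perturbation (R : realType) (x C B m : R) :
  (forall e, 0 < e -> x <= C * expR (B + e * m)) -> x <= C * expR B.
Proof.
move=> H.
have cv : C * expR (B + e * m) @[e --> (0 : R)^'+] --> C * expR (B + 0 * m).
  apply: cvgMr; apply: continuous_cvg; first exact: continuous_expR.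
  apply: cvgD; first exact: cvg_cst.
  by apply: cvgMl; apply: cvg_at_right_filter; exact: cvg_id.
rewrite mul0r addr0 in cv; apply: (cvgr_to_ge cv).
near=> e; apply: H; near: e; exact: nbhs_right_gt.
Unshelve. all: by end_near. Qed.

Theorem corollary1p2 (R : realType) (a u0 u1 : R -> R) (u : R -> R -> R)
    (a_C1 : C1_half a)
    (a_pos : forall t, 0 <= t -> 0 < a t)
    (a_bounded : has_ubound (a @` `[0, +oo[))
    (A0_pos : 0 < inf (a @` `[0, +oo[))
    (da_L1 : (@lebesgue_measure R).-integrable `]0, +oo[ (EFin \o derive1 a))
    (u0_test : test_function u0) (u1_test : test_function u1)
    (v1_L2 : L2 (fun x => \int[@lebesgue_measure R]_(y in `]-oo, x]) u1 y))
    (u_sol : strong_solution a u0 u1 u) :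
  let A0 := inf (a @` `[0, +oo[) in
  let v1 := fun x => \int[@lebesgue_measure R]_(y in `]-oo, x]) u1 y in
  let I0 := Num.sqrt (L2norm v1 ^+ 2 + a 0 ^+ 2 * L2norm u0 ^+ 2) in
  forall t, 0 <= t ->
    L2norm (u t) ^+ 2 <=
    1 / A0 ^+ 2 * I0 ^+ 2 *
    expR (2 / A0 * \int[@lebesgue_measure R]_(s in `]0, +oo[) `|derive1 a s|).
Proof.
move=> A0 v1 I0 T T0.
have [da [a_da c_da]] := a_C1.
have [M aM'] := a_bounded.
have aM t : 0 <= t -> a t <= M.
  by move=> t0; apply: aM'; exists t => //=; rewrite in_itv/= t0.
have aA0 t : 0 <= t -> A0 <= a t.
  move=> t0; apply: ge_inf; last by exists t => //=; rewrite in_itv/= t0.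
  by exists 0 => _ [s /= + <-]; rewrite in_itv/= andbT => /a_pos/ltW.
have [u_C0 _ _ [ut [utt [u_ut ut_utt wave eu0 eu1]]]] := u_sol.
have u_H2 t : 0 <= t -> Hk 2 (u t) by move=> t0; have [] := u_C0 t t0.
have S0 : 0 <= L2norm v1 ^+ 2 + a 0 ^+ 2 * L2norm u0 ^+ 2.
  by rewrite addr_ge0 ?sqr_ge0// mulr_ge0 ?sqr_ge0.
have int_da : \int[@lebesgue_measure R]_(s in `[0, T]) `|da s| <=
    \int[@lebesgue_measure R]_(s in `]0, +oo[) `|derive1 a s|.
  have daE s : 0 < s -> derive1 a s = da s.
    move=> s0; rewrite derive1E.
    by case: (half_deriv_is_derive s0 (a_da s (ltW s0))).
  have int_oy := integrable_norm da_L1.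
  have sub : `]0, T] `<=` `]0, +oo[ by exact: subset_itvl.
  have int_oT : (@lebesgue_measure R).-integrable `]0, T]
      (EFin \o (fun s => `|derive1 a s|)).
    exact: integrableS int_oy.
  rewrite -Rintegral_itv_obnd_cbnd; last first.
    apply: eq_integrable int_oT => // s; rewrite inE/= in_itv/= => /andP[s0 _].
    by rewrite daE.
  have -> : \int[@lebesgue_measure R]_(s in `]0, T]) `|da s| =
            \int[@lebesgue_measure R]_(s in `]0, T]) `|derive1 a s|.
    apply: eq_Rintegral => s; rewrite inE/= in_itv/= => /andP[s0 _].
    by rewrite daE.
  apply: fine_le; [exact: integrable_fin_num|exact: integrable_fin_num|].
  by apply: ge0_subset_integral => //; have /integrableP[] := int_oy.
have smooth_le e : 0 < e -> A0 ^+ 2 * L2norm (u T) ^+ 2 <= I0 ^+ 2 *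
    expR (2 / A0 * \int[@lebesgue_measure R]_(s in `]0, +oo[) `|derive1 a s| + e * (M * T)).
  move=> e0; rewrite sqr_sqrtr// sqr_L2norm.
  apply: (@le_trans _ _ (energy a u ut e T)).
    rewrite /energy ler_wpDl ?ip_ge0// ler_wpM2r ?ip_ge0//.
    by rewrite ler_pXn2r ?nnegrE ?(ltW A0_pos) ?(ltW (a_pos T T0))// aA0.
  apply: le_trans (energy_le A0_pos e0 aA0 aM a_da c_da u_ut ut_utt u_H2 wave T0) _.
  apply: ler_pM => //.
  - by rewrite /energy addr_ge0 ?ip_ge0// mulr_ge0 ?sqr_ge0 ?ip_ge0.
  - exact: energy0_le.
  - by rewrite ler_expR mulrA lerD2r ler_wpM2l// divr_ge0// ltW.
rewrite -mulrA div1r ler_pdivlMl ?exprn_gt0//.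
exact: le_expR_perturbation smooth_le.
Qed.
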